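(* Let $G$ be a finite group, let $A$ be a finite cyclic group and let $1\to A\to\tilde G\xrightarrow{\pi}G\to 1$ be a central extension. The modularization of the component of trivial degree of $D(\tilde{G})\text{-}\mathrm{mod}$, for the $\hat A$-grading described in the context, is the modular category $D(G)\text{-}\mathrm{mod}$.
   Context: Everything is over $\mathbb{C}$. For a finite group $H$, the Drinfeld double $D(H)$ is the Hopf algebra with basis $(e_gh)_{g,h\in H}$, multiplication $(e_gh)(e_{g'}h')=\delta_{g,hg'h^{-1}}e_g(hh')$, unit $\sum_g e_g$, coproduct $\Delta(e_gh)=\sum_{g_1g_2=g}e_{g_1}h\otimes e_{g_2}h$, counit $\varepsilon(e_gh)=\delta_{g,1}$, antipode $S(e_gh)=e_{h^{-1}g^{-1}h}h^{-1}$, and universal $R$-matrix $R=\sum_{g\in H}g\otimes e_g$. $D(H)\text{-}\mathrm{mod}$, the category of finite-dimensional modules, is a modular fusion category, with braiding given by $R$ followed by the flip and spherical structure given by the usual identification of a vector space with its bidual. Its simple objects are the $V_{g,\rho}$, $g\in H$ and $\rho$ an irreducible representation of the centralizer $Z_H(g)$, up to simultaneous conjugation: $V_{g,\rho}$ is supported on the conjugacy class of $g$ (i.e. $e_xV_{g,\rho}=0$ for $x$ not conjugate to $g$) and $e_gV_{g,\rho}\simeq\rho$ as a $Z_H(g)$-module. The group $A$ is viewed as a central subgroup of $\tilde G$. The one-dimensional modules $V_{a,1}$, $a\in A$, generate in $D(\tilde G)\text{-}\mathrm{mod}$ a subcategory equivalent to $\mathrm{Rep}(\hat A)$. This gives a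 grading of $D(\tilde G)\text{-}\mathrm{mod}$ by $\hat A$: an object $X$ has degree $\alpha\in\hat A$ if $c_{X,V_{a,1}}\circ c_{V_{a,1},X}=\alpha(a)\,\mathrm{id}$ for all $a\in A$. The trivial component is the one with $\alpha=1$. A modularization of a braided spherical fusion category $\mathcal D$ is a modular category $\mathcal M$ with a braided, twist-preserving tensor functor $F\colon\mathcal D\to\mathcal M$ that is dominant (every object of $\mathcal M$ is a direct summand of some $F(X)$); when it exists it is unique up to equivalence.
   Formalization: The braiding is taken to be the flip followed by R, x⊗y ↦ R(y⊗x), instead of R followed by the flip, because with the stated coproduct and R the latter is not a module morphism when the group is nonabelian. *)

(* Defs.v *)
From HB Require Import structures.
From mathcomp Require Import all_boot all_order all_algebra all_fingroup.
From mathcomp Require Import all_solvable.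
From mathcomp Require Import reals complex.

Set Implicit Arguments.
Unset Strict Implicit.
Unset Printing Implicit Defensive.

Import GRing.Theory.
Local Open Scope ring_scope.

(* A k-linear category with finite-dimensional Hom spaces, with the structure *)
(* maps of a braided pivotal monoidal category. No law is bundled: they are   *)
(* the predicates linear_category, ..., modular below.                        *)
Record bpdata (k : fieldType) := BPData {
  Obj : Type;
  Hom : Obj -> Obj -> vectType k;
  idm : forall X, Hom X X;
  compm : forall X Y Z, Hom Y Z -> Hom X Y -> Hom X Z;
  uobj : Obj;
  tobj : Obj -> Obj -> Obj;
  tmor : forall X X' Y Y', Hom X X' -> Hom Y Y' -> Hom (tobj X Y) (tobj X' Y');
  asc : forall X Y Z, Hom (tobj (tobj X Y) Z) (tobj X (tobj Y Z));
  ascI : forall X Y Z, Hom (tobj X (tobj Y Z)) (tobj (tobj X Y) Z);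
  lun : forall X, Hom (tobj uobj X) X;
  lunI : forall X, Hom X (tobj uobj X);
  run : forall X, Hom (tobj X uobj) X;
  runI : forall X, Hom X (tobj X uobj);
  brd : forall X Y, Hom (tobj X Y) (tobj Y X);
  dual : Obj -> Obj;
  ev : forall X, Hom (tobj (dual X) X) uobj;
  coev : forall X, Hom uobj (tobj X (dual X));
  piv : forall X, Hom X (dual (dual X));
  pivI : forall X, Hom (dual (dual X)) X
}.

Arguments Hom {k C} X Y : rename.
Arguments idm {k C} X : rename.
Arguments compm {k C X Y Z} g f : rename.
Arguments uobj {k C} : rename.
Arguments tobj {k C} X Y : rename.
Arguments tmor {k C X X' Y Y'} f g : rename.
Arguments asc {k C} X Y Z : rename.
Arguments ascI {k C} X Y Z : rename.
Arguments lun {k C} X : rename.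
Arguments lunI {k C} X : rename.
Arguments run {k C} X : rename.
Arguments runI {k C} X : rename.
Arguments brd {k C} X Y : rename.
Arguments dual {k C} X : rename.
Arguments ev {k C} X : rename.
Arguments coev {k C} X : rename.
Arguments piv {k C} X : rename.
Arguments pivI {k C} X : rename.

Declare Scope cat_scope.
Delimit Scope cat_scope with cat.
Notation "g ∘ f" := (compm g f) (at level 40, left associativity) : cat_scope.
Notation "X ⊗ Y" := (tobj X Y) (at level 35, right associativity) : cat_scope.
Notation "f ⊠ g" := (tmor f g) (at level 35, right associativity) : cat_scope.
Notation "X ^*" := (dual X) : cat_scope.
Notation "𝟙" := uobj : cat_scope.

Section CategoryLaws.
Local Open Scope cat_scope.
Variables (k : fieldType) (C : bpdata k).
Implicit Types X Y Z W : Obj C.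

Definition is_iso X Y (f : Hom X Y) :=
  exists g : Hom Y X, g ∘ f = idm X /\ f ∘ g = idm Y.

Definition isomorphic X Y := exists f : Hom X Y, is_iso f.

Definition is_mono X Y (f : Hom X Y) :=
  forall Z (g h : Hom Z X), f ∘ g = f ∘ h -> g = h.

Definition is_epi X Y (f : Hom X Y) :=
  forall Z (g h : Hom Y Z), g ∘ f = h ∘ f -> g = h.

Definition is_zero_obj X :=
  forall Y, (forall f : Hom X Y, f = 0) /\ (forall f : Hom Y X, f = 0).

Definition is_kernel K X Y (i : Hom K X) (f : Hom X Y) :=
  f ∘ i = 0 /\
  forall Z (g : Hom Z X), f ∘ g = 0 -> exists! h : Hom Z K, i ∘ h = g.

Definition is_cokernel X Y Q (f : Hom X Y) (q : Hom Y Q) :=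
  q ∘ f = 0 /\
  forall Z (g : Hom Y Z), g ∘ f = 0 -> exists! h : Hom Q Z, h ∘ q = g.

Definition linear_category :=
  [/\ forall X Y Z W (h : Hom Z W) (g : Hom Y Z) (f : Hom X Y),
        h ∘ (g ∘ f) = (h ∘ g) ∘ f,
      forall X Y (f : Hom X Y), idm Y ∘ f = f,
      forall X Y (f : Hom X Y), f ∘ idm X = f,
      forall X Y Z (g : Hom Y Z) a (f f' : Hom X Y),
        g ∘ (a *: f + f') = a *: (g ∘ f) + g ∘ f'
    & forall X Y Z (f : Hom X Y) a (g g' : Hom Y Z),
        (a *: g + g') ∘ f = a *: (g ∘ f) + g' ∘ f].

Definition has_biproduct X Y :=
  exists S (i1 : Hom X S) (i2 : Hom Y S) (p1 : Hom S X) (p2 : Hom S Y),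
    [/\ p1 ∘ i1 = idm X, p2 ∘ i2 = idm Y, p1 ∘ i2 = 0, p2 ∘ i1 = 0
      & i1 ∘ p1 + i2 ∘ p2 = idm S].

Definition abelian_category :=
  [/\ exists Z, is_zero_obj Z,
      forall X Y, has_biproduct X Y,
      forall X Y (f : Hom X Y), (exists K (i : Hom K X), is_kernel i f) /\
                                (exists Q (q : Hom Y Q), is_cokernel f q),
      forall X Y (f : Hom X Y), is_mono f ->
        exists Z (g : Hom Y Z), is_kernel f g
    & forall X Y (f : Hom X Y), is_epi f ->
        exists Z (g : Hom Z X), is_cokernel g f].

Definition simple_obj X :=
  ~ is_zero_obj X /\
  forall Y (f : Hom Y X), is_mono f -> f = 0 \/ is_iso f.

Definition sum_of_simples X :=
  exists n (S : 'I_n -> Obj C)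
         (i : forall j, Hom (S j) X) (p : forall j, Hom X (S j)),
    [/\ forall j, simple_obj (S j),
        forall j, p j ∘ i j = idm (S j),
        forall j l, j != l -> p j ∘ i l = 0
      & \sum_j (i j ∘ p j) = idm X].

Definition complete_simples n (S : 'I_n -> Obj C) :=
  [/\ forall j, simple_obj (S j),
      forall j l, isomorphic (S j) (S l) -> j = l
    & forall X, simple_obj X -> exists j, isomorphic X (S j)].

Definition finite_semisimple :=
  (forall X, sum_of_simples X) /\
  exists n (S : 'I_n -> Obj C), complete_simples S.

Definition tensor_bilinear_functor :=
  [/\ forall X Y, idm X ⊠ idm Y = idm (X ⊗ Y),
      forall X X' X'' Y Y' Y'' (f : Hom X X') (f' : Hom X' X'')
             (g : Hom Y Y') (g' : Hom Y' Y''),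
        (f' ∘ f) ⊠ (g' ∘ g) = (f' ⊠ g') ∘ (f ⊠ g),
      forall X X' Y Y' (g : Hom Y Y') a (f f' : Hom X X'),
        (a *: f + f') ⊠ g = a *: (f ⊠ g) + f' ⊠ g
    & forall X X' Y Y' (f : Hom X X') a (g g' : Hom Y Y'),
        f ⊠ (a *: g + g') = a *: (f ⊠ g) + f ⊠ g'].

Definition associator_laws :=
  [/\ forall X Y Z, ascI X Y Z ∘ asc X Y Z = idm _,
      forall X Y Z, asc X Y Z ∘ ascI X Y Z = idm _,
      forall X X' Y Y' Z Z' (f : Hom X X') (g : Hom Y Y') (h : Hom Z Z'),
        asc X' Y' Z' ∘ ((f ⊠ g) ⊠ h) = (f ⊠ (g ⊠ h)) ∘ asc X Y Z
    & forall X Y Z W,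
        asc X Y (Z ⊗ W) ∘ asc (X ⊗ Y) Z W
        = (idm X ⊠ asc Y Z W) ∘ asc X (Y ⊗ Z) W ∘ (asc X Y Z ⊠ idm W)].

Definition unitor_laws :=
  [/\ forall X, lunI X ∘ lun X = idm _ /\ lun X ∘ lunI X = idm _,
      forall X, runI X ∘ run X = idm _ /\ run X ∘ runI X = idm _,
      forall X Y (f : Hom X Y), lun Y ∘ (idm 𝟙 ⊠ f) = f ∘ lun X,
      forall X Y (f : Hom X Y), run Y ∘ (f ⊠ idm 𝟙) = f ∘ run X
    & forall X Y, (idm X ⊠ lun Y) ∘ asc X 𝟙 Y = run X ⊠ idm Y].

Definition monoidal_category :=
  [/\ tensor_bilinear_functor, associator_laws & unitor_laws].

Definition braided_category :=
  [/\ forall X Y, is_iso (brd X Y),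
      forall X X' Y Y' (f : Hom X X') (g : Hom Y Y'),
        brd X' Y' ∘ (f ⊠ g) = (g ⊠ f) ∘ brd X Y,
      forall X Y Z,
        asc Y Z X ∘ brd X (Y ⊗ Z) ∘ asc X Y Z
        = (idm Y ⊠ brd X Z) ∘ asc Y X Z ∘ (brd X Y ⊠ idm Z)
    & forall X Y Z,
        ascI Z X Y ∘ brd (X ⊗ Y) Z ∘ ascI X Y Z
        = (brd X Z ⊠ idm Y) ∘ ascI X Z Y ∘ (idm X ⊠ brd Y Z)].

Definition rigid_category :=
  (forall X, run X ∘ (idm X ⊠ ev X) ∘ asc X X^* X ∘ (coev X ⊠ idm X) ∘ lunI X
             = idm X) /\
  (forall X, lun X^* ∘ (ev X ⊠ idm X^*) ∘ ascI X^* X X^*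
               ∘ (idm X^* ⊠ coev X) ∘ runI X^*
             = idm X^*).

(* In a rigid category, the unique q : B -> X^* with ev X ∘ (q ⊠ idm X) = p. *)
Definition mate B X (p : Hom (B ⊗ X) 𝟙) : Hom B X^* :=
  lun X^* ∘ (p ⊠ idm X^*) ∘ ascI B X X^* ∘ (idm B ⊠ coev X) ∘ runI B.

Definition dualm X Y (f : Hom X Y) : Hom Y^* X^* :=
  mate (ev Y ∘ (idm Y^* ⊠ f)).

(* The canonical isomorphism; for vector spaces, it maps psi (x) phi to       *)
(* x (x) y |-> phi x * psi y.                                                 *)
Definition dual_tensor X Y : Hom (Y^* ⊗ X^*) (X ⊗ Y)^* :=
  mate (ev Y ∘ (idm Y^* ⊠ (lun Y ∘ (ev X ⊠ idm Y) ∘ ascI X^* X Y))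
          ∘ asc Y^* X^* (X ⊗ Y)).

Definition pivotal_category :=
  [/\ forall X, pivI X ∘ piv X = idm _ /\ piv X ∘ pivI X = idm _,
      forall X Y (f : Hom X Y), piv Y ∘ f = dualm (dualm f) ∘ piv X
    & forall X Y, dualm (dual_tensor X Y) ∘ piv (X ⊗ Y)
                  = dual_tensor Y^* X^* ∘ (piv X ⊠ piv Y)].

Definition evr X : Hom (X ⊗ X^*) 𝟙 := ev X^* ∘ (piv X ⊠ idm X^*).

Definition coevr X : Hom 𝟙 (X^* ⊗ X) := (idm X^* ⊠ pivI X) ∘ coev X^*.

Definition rtrace X (f : Hom X X) : Hom 𝟙 𝟙 := evr X ∘ (f ⊠ idm X^*) ∘ coev X.

Definition ltrace X (f : Hom X X) : Hom 𝟙 𝟙 := ev X ∘ (idm X^* ⊠ f) ∘ coevr X.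

Definition spherical_category :=
  forall X (f : Hom X X), ltrace f = rtrace f.

Definition twist X : Hom X X :=
  run X ∘ (idm X ⊠ evr X) ∘ asc X X X^* ∘ (brd X X ⊠ idm X^*)
    ∘ ascI X X X^* ∘ (idm X ⊠ coev X) ∘ runI X.

Definition fusion_category :=
  [/\ linear_category /\ abelian_category, finite_semisimple,
      monoidal_category, rigid_category
    & \dim {: @Hom k C 𝟙 𝟙} = 1%N].

Definition braided_spherical_fusion :=
  [/\ fusion_category, braided_category, pivotal_category
    & spherical_category].

(* T is the S-matrix, read in k through k = End(𝟙). *)
Definition modular :=
  braided_spherical_fusion /\
  exists n (S : 'I_n -> Obj C) (T : 'M[k]_n),
    [/\ complete_simples S,
        forall i j, rtrace (brd (S j) (S i) ∘ brd (S i) (S j)) = T i j *: idm 𝟙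
      & T \in unitmx].

End CategoryLaws.

Section FullSubcategory.
Local Open Scope cat_scope.
Variables (k : fieldType) (C : bpdata k) (P : Obj C -> Prop).
Hypotheses (P1 : P 𝟙) (Pt : forall X Y, P X -> P Y -> P (X ⊗ Y)).
Hypothesis (Pd : forall X, P X -> P X^*).

Definition full_sub : bpdata k :=
  @BPData k {X : Obj C | P X}
    (fun X Y => Hom (sval X) (sval Y))
    (fun X => idm (sval X))
    (fun X Y Z g f => g ∘ f)
    (exist _ 𝟙 P1)
    (fun X Y => exist _ (sval X ⊗ sval Y) (Pt (svalP X) (svalP Y)))
    (fun X X' Y Y' f g => f ⊠ g)
    (fun X Y Z => asc (sval X) (sval Y) (sval Z))
    (fun X Y Z => ascI (sval X) (sval Y) (sval Z))
    (fun X => lun (sval X)) (fun X => lunI (sval X))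
    (fun X => run (sval X)) (fun X => runI (sval X))
    (fun X Y => brd (sval X) (sval Y))
    (fun X => exist _ (sval X)^* (Pd (svalP X)))
    (fun X => ev (sval X)) (fun X => coev (sval X))
    (fun X => piv (sval X)) (fun X => pivI (sval X)).

End FullSubcategory.

Record functor_data (k : fieldType) (C D : bpdata k) := FunctorData {
  fobj :> Obj C -> Obj D;
  fmor : forall X Y : Obj C, Hom X Y -> Hom (fobj X) (fobj Y);
  funit : Hom uobj (fobj uobj);
  fmon : forall X Y : Obj C, Hom (tobj (fobj X) (fobj Y)) (fobj (tobj X Y))
}.

Section Functors.
Local Open Scope cat_scope.
Variables (k : fieldType) (C D : bpdata k) (F : functor_data C D).

Definition linear_functor :=
  [/\ forall X, fmor F (idm X) = idm (F X),
      forall X Y Z (g : Hom Y Z) (f : Hom X Y),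
        fmor F (g ∘ f) = fmor F g ∘ fmor F f
    & forall X Y a (f f' : Hom X Y),
        fmor F (a *: f + f') = a *: fmor F f + fmor F f'].

Definition tensor_functor :=
  [/\ linear_functor,
      is_iso (funit F) /\ (forall X Y, is_iso (fmon F X Y)),
      forall X X' Y Y' (f : Hom X X') (g : Hom Y Y'),
        fmon F X' Y' ∘ (fmor F f ⊠ fmor F g) = fmor F (f ⊠ g) ∘ fmon F X Y,
      forall X Y Z,
        fmor F (asc X Y Z) ∘ fmon F (X ⊗ Y) Z ∘ (fmon F X Y ⊠ idm (F Z))
        = fmon F X (Y ⊗ Z) ∘ (idm (F X) ⊠ fmon F Y Z) ∘ asc (F X) (F Y) (F Z)
    & forall X,
        lun (F X) = fmor F (lun X) ∘ fmon F 𝟙 X ∘ (funit F ⊠ idm (F X)) /\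
        run (F X) = fmor F (run X) ∘ fmon F X 𝟙 ∘ (idm (F X) ⊠ funit F)].

Definition braided_functor :=
  forall X Y, fmor F (brd X Y) ∘ fmon F X Y = fmon F Y X ∘ brd (F X) (F Y).

Definition twist_preserving := forall X, fmor F (twist X) = twist (F X).

Definition dominant :=
  forall Y : Obj D, exists X (i : Hom Y (F X)) (p : Hom (F X) Y),
    p ∘ i = idm Y.

End Functors.

Definition is_modularization (k : fieldType) (D M : bpdata k) :=
  [/\ braided_spherical_fusion D, modular M
    & exists F : functor_data D M,
        [/\ tensor_functor F, braided_functor F, twist_preserving F
          & dominant F]].

Section LinearAlgebra.
Variable k : fieldType.
Implicit Types U V W : vectType k.

Lemma linfunE U V (f : U -> V) : linear f -> forall u, linfun f u = f u.
Proof.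
move=> lin_f u.
pose F : {linear U -> V} := HB.pack f (GRing.isLinear.Build k U V *:%R f lin_f).
by rewrite (lfunE F).
Qed.

Lemma linear_comb U V (f : U -> V) (I : finType) (c : I -> k) (x : I -> U) :
  linear f -> f (\sum_i c i *: x i) = \sum_i c i *: f (x i).
Proof.
move=> lf; rewrite -(linfunE lf) linear_sum; apply: eq_bigr => i _.
by rewrite linearZ /= (linfunE lf).
Qed.

Definition bilin U V W (b : U -> V -> W) :=
  (forall v, linear (b^~ v)) /\ (forall u, linear (b u)).

(* The tensor product, as matrices of coordinates in the bases vbasis. It is  *)
(* only used through its universal property: pure_bilin, tliftE, tens_ext.    *)
Definition tens U V : vectType k := 'M[k]_(\dim {:U}, \dim {:V}).

Definition pure U V (u : U) (v : V) : tens U V :=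
  \matrix_(i, j) (coord (vbasis fullv) i u * coord (vbasis fullv) j v).

Definition tlift U V W (b : U -> V -> W) : 'Hom(tens U V, W) :=
  linfun (fun t : tens U V =>
    \sum_i \sum_j t i j *: b (vbasis fullv)`_i (vbasis fullv)`_j).

Lemma pure_bilin U V : bilin (@pure U V).
Proof.
split=> x a y z; apply/matrixP=> i j; rewrite !mxE linearP /=.
  by rewrite mulrDl mulrA.
by rewrite mulrDr mulrCA.
Qed.

Lemma tlift_lin U V W (b : U -> V -> W) :
  linear (fun t : tens U V =>
    \sum_i \sum_j t i j *: b (vbasis fullv)`_i (vbasis fullv)`_j).
Proof.
move=> a s t; rewrite scaler_sumr -big_split /=; apply: eq_bigr => i _.
rewrite scaler_sumr -big_split /=; apply: eq_bigr => j _.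
by rewrite !mxE scalerDl scalerA.
Qed.

Lemma tliftE U V W (b : U -> V -> W) :
  bilin b -> forall u v, tlift b (pure u v) = b u v.
Proof.
case=> bl br u v; rewrite /tlift linfunE; last exact: tlift_lin.
rewrite [in RHS](coord_vbasis (memvf u)) [RHS](linear_comb _ _ (bl v)).
apply: eq_bigr => i _; rewrite [in RHS](coord_vbasis (memvf v)).
rewrite [X in _ *: X](linear_comb _ _ (br _)) scaler_sumr.
by apply: eq_bigr => j _; rewrite !mxE scalerA.
Qed.

Lemma tens_ind U V (P : tens U V -> Prop) :
  (forall u v, P (pure u v)) -> (forall s t, P s -> P t -> P (s + t)) ->
  forall t, P t.
Proof.
move=> Pp PD t; have P0 : P 0.
  rewrite -(scale0r (pure 0 0 : tens U V)).
  suff -> : 0 *: (pure 0 0 : tens U V) = pure 0 0 by [].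
  by apply/matrixP=> i j; rewrite !mxE linear0 !mul0r.
pose e i := (vbasis (fullv : {vspace U}))`_i.
pose f i := (vbasis (fullv : {vspace V}))`_i.
have -> : t = \sum_i \sum_j (pure (t i j *: e i) (f j) : tens U V).
  apply/matrixP=> i j; rewrite summxE (bigD1 i) //= [X in _ + X]big1.
    rewrite addr0 summxE (bigD1 j) //= [X in _ + X]big1.
      rewrite addr0 mxE linearZ /=.
      rewrite !coord_free ?(basis_free (vbasisP _)) // !eqxx.
      by rewrite !mulr1.
    move=> l ljn; rewrite mxE linearZ /=.
    rewrite !coord_free ?(basis_free (vbasisP _)) // (negPf ljn).
    by rewrite mulr0.
  move=> l lin; rewrite summxE big1 // => m _; rewrite mxE linearZ /=.
  rewrite !coord_free ?(basis_free (vbasisP _)) // (negPf lin).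
  by rewrite mulr0 mul0r.
by elim/big_ind: _ => // i _; elim/big_ind: _.
Qed.

Lemma tens_ext U V W (f g : 'Hom(tens U V, W)) :
  (forall u v, f (pure u v) = g (pure u v)) -> f = g.
Proof.
move=> fg; apply/lfunP; elim/tens_ind => // s t Es Et.
by rewrite !linearD /= Es Et.
Qed.

Definition tmap U U' V V' (f : 'Hom(U, U')) (g : 'Hom(V, V')) :
  'Hom(tens U V, tens U' V') := tlift (fun u v => pure (f u) (g v)).

End LinearAlgebra.

Section Double.
Variables (k : fieldType) (H : finGroupType).

(* The algebra D(H); dbl g h is the basis element e_g h. *)
Definition double : Type := {ffun H * H -> k^o}.
HB.instance Definition _ := Vector.on double.

Definition dbl (g h : H) : double := [ffun p => ((p == (g, h))%:R : k)].

Definition dlift (W : vectType k) (f : H -> H -> W) : 'Hom(double, W) :=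
  linfun (fun x : double => \sum_p (x p : k) *: f p.1 p.2).

Lemma dlift_lin (W : vectType k) (f : H -> H -> W) :
  linear (fun x : double => \sum_p (x p : k) *: f p.1 p.2).
Proof.
move=> a x y; rewrite scaler_sumr -big_split /=; apply: eq_bigr => p _.
by rewrite !ffunE scalerDl scalerA.
Qed.

Lemma dlift_sum (W : vectType k) (f : H -> H -> W) x :
  dlift f x = \sum_p (x p : k) *: f p.1 p.2.
Proof. by rewrite /dlift linfunE //; exact: dlift_lin. Qed.

Lemma dliftE (W : vectType k) (f : H -> H -> W) g h : dlift f (dbl g h) = f g h.
Proof.
rewrite dlift_sum (bigD1 (g, h)) //= ffunE eqxx scale1r big1 ?addr0 // => p pn.
by rewrite ffunE (negPf pn) scale0r.
Qed.

Lemma double_sum (x : double) : x = \sum_p (x p : k) *: dbl p.1 p.2.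
Proof.
apply/ffunP=> q; rewrite sum_ffunE (bigD1 q) //= big1 ?addr0 => [|p pn].
  by rewrite !ffunE -surjective_pairing eqxx /GRing.scale /= mulr1.
rewrite !ffunE -surjective_pairing eq_sym (negPf pn).
by rewrite /GRing.scale /= mulr0.
Qed.

Lemma double_ext (W : vectType k) (f f' : 'Hom(double, W)) :
  (forall g h, f (dbl g h) = f' (dbl g h)) -> f = f'.
Proof.
move=> ff'; apply/lfunP=> x; rewrite [x]double_sum !linear_sum /=.
by apply: eq_bigr => p _; rewrite !linearZ /= ff'.
Qed.

Definition dmul (x y : double) : double :=
  dlift (fun g h => dlift (fun g' h' =>
    if g == (h * g' * h^-1)%g then dbl g (h * h')%g else 0) y) x.

Definition dsum1 : double := \sum_g dbl g 1%g.

Lemma dmul_bilin : bilin dmul.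
Proof.
split=> [y a x x'|x a y y']; first by rewrite /dmul linearP.
rewrite /dmul !dlift_sum scaler_sumr -big_split /=; apply: eq_bigr => p _.
by rewrite linearP scalerDr !scalerA mulrC.
Qed.

Lemma dmulE g h g' h' :
  dmul (dbl g h) (dbl g' h') =
    if g == (h * g' * h^-1)%g then dbl g (h * h')%g else 0.
Proof. by rewrite /dmul !dliftE. Qed.

Lemma double_ind (P : double -> Prop) :
  (forall g h, P (dbl g h)) -> (forall a x y, P x -> P y -> P (a *: x + y)) ->
  forall x, P x.
Proof.
move=> Pb PD x; have P0 : P 0.
  by have := PD (-1) _ _ (Pb 1%g 1%g) (Pb 1%g 1%g); rewrite scaleN1r addNr.
rewrite [x]double_sum; elim/big_rec: _ => // p y _ Py; exact: PD.
Qed.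

Lemma dmulA : associative dmul.
Proof.
have [dl dr] := dmul_bilin.
have dx0 x : dmul x 0 = 0.
  by have := dr x (-1) x x; rewrite !scaleN1r !addNr.
have d0x x : dmul 0 x = 0.
  by have := dl x (-1) x x; rewrite !scaleN1r !addNr.
elim/double_ind=> [g h|a x x' Ex Ex'] y z; last first.
  by rewrite !dl Ex Ex'.
elim/double_ind: y z => [g' h'|a x x' Ex Ex'] z; last first.
  by rewrite dl !dr Ex Ex' dl.
elim/double_ind: z => [g'' h''|a x x' Ex Ex']; last by rewrite !dr Ex Ex'.
rewrite !dmulE (fun_if (dmul (dbl g h))) (fun_if (fun x => dmul x (dbl g'' h''))).
rewrite dx0 d0x !dmulE mulgA.
have [->|] := eqVneq g (h * g' * h^-1)%g; last by case: ifP.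
rewrite invMg !mulgA (inj_eq (mulIg _)) -!mulgA (inj_eq (mulgI _)).
by rewrite !mulgA.
Qed.

Lemma dmul1x : left_id dsum1 dmul.
Proof.
have [dl dr] := dmul_bilin.
elim/double_ind=> [g h|a x y Ex Ey]; last by rewrite dr Ex Ey.
rewrite /dsum1 /dmul linear_sum /= (bigD1 g) //= big1 ?addr0 => [|x xg].
  by rewrite !dliftE !(mul1g, mulg1, invg1) eqxx.
by rewrite !dliftE !(mul1g, mulg1, invg1) (negPf xg).
Qed.

Lemma dmulx1 : right_id dsum1 dmul.
Proof.
have [dl dr] := dmul_bilin.
elim/double_ind=> [g h|a x y Ex Ey]; last by rewrite dl Ex Ey.
rewrite /dsum1 /dmul dliftE linear_sum /= (bigD1 (g ^ h)%g) //= big1 ?addr0.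
  by rewrite dliftE mulg1 conjgE !mulgA mulgK mulgV mul1g eqxx.
move=> x xg; rewrite dliftE; case: eqP => // e; case/eqP: xg.
by rewrite e conjgE !mulgA mulVg mul1g mulgKV.
Qed.

Lemma dmulDl : left_distributive dmul +%R.
Proof. by move=> x y z; rewrite /dmul linearD. Qed.

Lemma dmulDr : right_distributive dmul +%R.
Proof.
have [_ dr] := dmul_bilin.
by move=> x y z; rewrite -[y]scale1r dr !scale1r.
Qed.

Lemma dsum1_neq0 : dsum1 != 0.
Proof.
apply/eqP=> /ffunP/(_ (1%g, 1%g)); rewrite sum_ffunE ffunE (bigD1 1%g) //=.
rewrite big1 ?addr0 => [|g gn1]; first by rewrite ffunE eqxx => /eqP; rewrite oner_eq0.
by rewrite ffunE xpair_eqE eq_sym (negPf gn1).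
Qed.

HB.instance Definition _ := GRing.Zmodule_isNzRing.Build double
  dmulA dmul1x dmulx1 dmulDl dmulDr dsum1_neq0.

Lemma dscaleAl (a : k) (x y : double) : a *: (x * y) = (a *: x) * y.
Proof. by rewrite /GRing.mul /= /dmul linearZ. Qed.

Lemma dscaleAr (a : k) (x y : double) : a *: (x * y) = x * (a *: y).
Proof.
have [_ dr] := dmul_bilin.
have dx0 : dmul x 0 = 0 by have := dr x (-1) x x; rewrite !scaleN1r !addNr.
by rewrite /GRing.mul /= -[a *: y]addr0 dr dx0 addr0.
Qed.

HB.instance Definition _ := GRing.Lmodule_isLalgebra.Build k double dscaleAl.
HB.instance Definition _ := GRing.Lalgebra_isAlgebra.Build k double dscaleAr.

Lemma dblM g h g' h' :
  dbl g h * dbl g' h' =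
    if g == (h * g' * h^-1)%g then dbl g (h * h')%g else 0.
Proof. exact: dmulE. Qed.

Definition comult : 'Hom(double, tens double double) :=
  dlift (fun g h => \sum_(p : H * H | (p.1 * p.2)%g == g)
                      pure (dbl p.1 h) (dbl p.2 h)).

Definition counit : 'Hom(double, k^o) :=
  dlift (fun g _ => (g == 1%g)%:R : k^o).

Definition antipode : 'Hom(double, double) :=
  dlift (fun g h => dbl (h^-1 * g^-1 * h)%g h^-1%g).

(* The group element h, seen in D(H). *)
Definition gdbl (h : H) : double := \sum_g dbl g h.

Definition Rmx : tens double double := \sum_g pure (gdbl g) (dbl g 1%g).

End Double.

Section Modules.
Variables (k : fieldType) (H : finGroupType).
Local Notation D := (double k H).
Local Notation e_ := (@dbl k H).

Record dmod := DMod {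
  dcar :> vectType k;
  dact : 'Hom(D, 'End(dcar));
  dact1 : dact 1 = \1%VF;
  dactM : forall x y, dact (x * y) = (dact x \o dact y)%VF
}.

Lemma dact1E (X : dmod) (v : X) : \sum_g dact X (e_ g 1%g) v = v.
Proof.
have e1 : dact X (\sum_g e_ g 1%g) = \1%VF := dact1 X.
by rewrite -sum_lfunE -linear_sum /= e1 id_lfunE.
Qed.

Lemma dactME (X : dmod) g h g' h' (v : X) :
  dact X (e_ g h) (dact X (e_ g' h') v) =
    if g == (h * g' * h^-1)%g then dact X (e_ g (h * h')%g) v else 0.
Proof.
rewrite -comp_lfunE -dactM dblM; case: ifP => // _.
by rewrite linear0 zero_lfunE.
Qed.

Section Build.
Variables (V : vectType k) (r : 'Hom(D, 'End(V))).
Hypothesis r1 : forall v, \sum_g r (e_ g 1%g) v = v.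
Hypothesis rM : forall g h g' h' v,
  r (e_ g h) (r (e_ g' h') v) =
    if g == (h * g' * h^-1)%g then r (e_ g (h * h')%g) v else 0.

Lemma build_dact1 : r 1 = \1%VF.
Proof.
apply/lfunP=> v; rewrite id_lfunE -[RHS]r1 -sum_lfunE -linear_sum.
by [].
Qed.

Lemma build_dactM x y : r (x * y) = (r x \o r y)%VF.
Proof.
elim/double_ind: x y => [g h|a x x' Ex Ex'] y; last first.
  rewrite mulrDl -scalerAl !linearP /= Ex Ex'.
  by rewrite comp_lfunDl -comp_lfunZl.
elim/double_ind: y => [g' h'|a x x' Ex Ex']; last first.
  rewrite mulrDr -scalerAr !linearP /= Ex Ex'.
  by rewrite comp_lfunDr -comp_lfunZr.
rewrite dblM; apply/lfunP=> v; rewrite comp_lfunE rM.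
by case: ifP => // _; rewrite linear0 zero_lfunE.
Qed.

Definition build_dmod := DMod build_dact1 build_dactM.
End Build.

Definition dhom_defect (X Y : dmod) (x : D) (f : 'Hom(X, Y)) : 'Hom(X, Y) :=
  ((f \o dact X x) - (dact Y x \o f))%VF.

Definition dhom (X Y : dmod) : {vspace 'Hom(X, Y)} :=
  (\bigcap_(p : H * H) lker (linfun (@dhom_defect X Y (e_ p.1 p.2))))%VS.

Lemma dhom_defect_lin X Y x : linear (@dhom_defect X Y x).
Proof.
move=> a f g; rewrite /dhom_defect comp_lfunDl comp_lfunDr -comp_lfunZl.
by rewrite -comp_lfunZr scalerBr opprD addrACA.
Qed.

Lemma dhomP (X Y : dmod) (f : 'Hom(X, Y)) :
  reflect (forall x v, f (dact X x v) = dact Y x (f v)) (f \in dhom X Y).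
Proof.
apply: (iffP idP) => [fH x v|fH].
  elim/double_ind: x => [g h|a x y Ex Ey]; last first.
    by rewrite !linearP /= !add_lfunE !scale_lfunE linearP /= Ex Ey.
  have: f \in lker (linfun (@dhom_defect X Y (e_ g h))).
    by move: fH; rewrite memvE => /subv_bigcapP/(_ (g, h) isT); rewrite -memvE.
  rewrite memv_ker linfunE; last exact: dhom_defect_lin.
  rewrite subr_eq0 => /eqP /lfunP /(_ v); by rewrite !comp_lfunE.
rewrite memvE; apply/subv_bigcapP=> p _; rewrite -memvE memv_ker.
rewrite linfunE; last exact: dhom_defect_lin.
by rewrite subr_eq0; apply/eqP/lfunP=> v; rewrite !comp_lfunE.
Qed.

Lemma dhom_basisP (X Y : dmod) (f : 'Hom(X, Y)) :
  (forall g h v, f (dact X (e_ g h) v) = dact Y (e_ g h) (f v)) ->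
  f \in dhom X Y.
Proof.
move=> fH; apply/dhomP=> x v; elim/double_ind: x => // a x y Ex Ey.
by rewrite !linearP /= !add_lfunE !scale_lfunE linearP /= Ex Ey.
Qed.

Definition dHom (X Y : dmod) : vectType k := subvs_of (dhom X Y).

Definition dmorph (X Y : dmod) (f : 'Hom(X, Y)) (fH : f \in dhom X Y) :
  dHom X Y := Subvs fH.

Lemma did_subproof (X : dmod) : \1%VF \in dhom X X.
Proof. by apply/dhomP=> x v; rewrite !id_lfunE. Qed.

Lemma dcomp_subproof (X Y Z : dmod) (g : dHom Y Z) (f : dHom X Y) :
  (vsval g \o vsval f)%VF \in dhom X Z.
Proof.
apply/dhomP=> x v; rewrite !comp_lfunE (dhomP _ (subvsP f)).
by rewrite (dhomP _ (subvsP g)).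
Qed.

Definition dunit_act : 'Hom(D, 'End(k^o)) :=
  linfun (fun x : D => (counit k H x : k) *: \1%VF).

Lemma dunit_actE x v : dunit_act x v = (counit k H x : k) *: v.
Proof.
rewrite linfunE ?scale_lfunE ?id_lfunE // => a y z.
by rewrite linearP scalerDl -scalerA.
Qed.

Lemma counitE g h : counit k H (e_ g h) = (g == 1%g)%:R.
Proof. exact: dliftE. Qed.

Lemma dunit1_subproof v : \sum_g dunit_act (e_ g 1%g) v = v.
Proof.
rewrite (bigD1 1%g) //= big1 => [|g gn1].
  by rewrite addr0 dunit_actE counitE eqxx scale1r.
by rewrite dunit_actE counitE (negPf gn1) scale0r.
Qed.

Lemma dunitM_subproof g h g' h' v :
  dunit_act (e_ g h) (dunit_act (e_ g' h') v) =
    if g == (h * g' * h^-1)%g then dunit_act (e_ g (h * h')%g) v else 0.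
Proof.
rewrite !dunit_actE !counitE.
have [->|ne] := eqVneq g (h * g' * h^-1)%g.
  have -> : (h * g' * h^-1 == 1)%g = (g' == 1%g).
    by rewrite -eq_mulgV1 -[in X in _ == X](mulg1 h) (inj_eq (mulgI h)).
  by case: eqP => _; rewrite ?scale1r // !scale0r.
have [g1|] := eqVneq g 1%g; last by rewrite scale0r.
have [g'1|] := eqVneq g' 1%g; last by rewrite scale0r scaler0.
by rewrite g1 g'1 mulg1 mulgV eqxx in ne.
Qed.

Definition dunit : dmod := build_dmod dunit1_subproof dunitM_subproof.

Definition dact2 (X Y : dmod) : 'Hom(tens D D, 'End(tens X Y)) :=
  tlift (fun x y => tmap (dact X x) (dact Y y)).

Lemma tmapE (U U' V V' : vectType k) (f : 'Hom(U, U')) (g : 'Hom(V, V')) u v :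
  tmap f g (pure u v) = pure (f u) (g v).
Proof.
have [pl pr] := @pure_bilin k U' V'.
by rewrite tliftE //; split=> x a y z; rewrite linearP ?pl ?pr.
Qed.

Lemma dact2E (X Y : dmod) x y u v :
  dact2 X Y (pure x y) (pure u v) = pure (dact X x u) (dact Y y v).
Proof.
have [pl pr] := @pure_bilin k X Y.
rewrite /dact2 tliftE ?tmapE //; split=> z a s t; apply: tens_ext => u' v';
  rewrite add_lfunE scale_lfunE !tmapE linearP /= add_lfunE scale_lfunE.
  by rewrite pl.
by rewrite pr.
Qed.

Definition dtens_act (X Y : dmod) : 'Hom(D, 'End(tens X Y)) :=
  (dact2 X Y \o comult k H)%VF.

Lemma dtens_actE (X Y : dmod) g h u v :
  dtens_act X Y (e_ g h) (pure u v) =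
    \sum_(p : H * H | (p.1 * p.2)%g == g)
      pure (dact X (e_ p.1 h) u) (dact Y (e_ p.2 h) v).
Proof.
rewrite comp_lfunE dliftE linear_sum sum_lfunE /=.
by apply: eq_bigr => p _; rewrite dact2E.
Qed.

Lemma pure_suml (U V : vectType k) (I : finType) (P : pred I) (f : I -> U) v :
  pure (\sum_(i | P i) f i) v = \sum_(i | P i) (pure (f i) v : tens U V).
Proof.
have [pl _] := @pure_bilin k U V.
by rewrite -(linfunE (pl v)) linear_sum; apply: eq_bigr => i _; rewrite /= (linfunE (pl v)).
Qed.

Lemma pure_sumr (U V : vectType k) (I : finType) (P : pred I) u (f : I -> V) :
  pure u (\sum_(i | P i) f i) = \sum_(i | P i) (pure u (f i) : tens U V).
Proof.
have [_ pr] := @pure_bilin k U V.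
by rewrite -(linfunE (pr u)) linear_sum; apply: eq_bigr => i _; rewrite /= (linfunE (pr u)).
Qed.

Lemma pure0l (U V : vectType k) v : pure (0 : U) v = 0 :> tens U V.
Proof. by have := pure_suml (I := bool) pred0 (fun _ => 0 : U) v; rewrite !big_pred0_eq. Qed.

Lemma pure0r (U V : vectType k) u : pure u (0 : V) = 0 :> tens U V.
Proof. by have := pure_sumr (I := bool) pred0 u (fun _ => 0 : V); rewrite !big_pred0_eq. Qed.

Lemma dtens1_subproof (X Y : dmod) t : \sum_g dtens_act X Y (e_ g 1%g) t = t.
Proof.
elim/tens_ind: t => [u v|s t Es Et].
  transitivity (\sum_(p : H * H)
      pure (dact X (e_ p.1 1%g) u) (dact Y (e_ p.2 1%g) v)).
    rewrite [RHS](partition_big (fun p : H * H => (p.1 * p.2)%g) xpredT) //=.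
    by apply: eq_bigr => g _; rewrite dtens_actE.
  rewrite -[u in RHS]dact1E -[v in RHS]dact1E pure_suml.
  under [RHS]eq_bigr do rewrite pure_sumr.
  by rewrite pair_big.
by rewrite -[in RHS]Es -[in RHS]Et -big_split; apply: eq_bigr => g _; rewrite linearD.
Qed.

Lemma dtensM_subproof (X Y : dmod) g h g' h' t :
  dtens_act X Y (e_ g h) (dtens_act X Y (e_ g' h') t) =
    if g == (h * g' * h^-1)%g then dtens_act X Y (e_ g (h * h')%g) t else 0.
Proof.
elim/tens_ind: t => [u v|s t Es Et]; last first.
  by rewrite !linearD /= Es Et; case: ifP => _; rewrite ?addr0.
rewrite dtens_actE linear_sum /=.
under eq_bigr do rewrite dtens_actE.
rewrite exchange_big /=.
pose c (p : H * H) : H * H := ((p.1 ^ h)%g, (p.2 ^ h)%g).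
have cE x y : (x == h * y * h^-1)%g = (y == x ^ h)%g.
  by rewrite conjgE -(inj_eq (mulgI h^-1%g)) -(inj_eq (mulIg h)) eq_sym !mulgA mulVg mul1g mulgKV.
rewrite cE.
transitivity (\sum_(p : H * H | (p.1 * p.2)%g == g)
  if g' == (g ^ h)%g then pure (dact X (e_ p.1 (h * h')%g) u) (dact Y (e_ p.2 (h * h')%g) v) else 0).
  apply: eq_bigr => p /eqP pg.
  under eq_bigr do rewrite !dactME !cE.
  have [e|ne] := eqVneq g' (g ^ h)%g.
    rewrite (bigD1 (c p)) /=; last by rewrite -conjMg pg e.
    rewrite !eqxx big1 ?addr0 // => q /andP[_ qc].
    case: eqP => [e1|]; last by rewrite pure0l.
    case: eqP => [e2|]; last by rewrite pure0r.
    by case/eqP: qc; rewrite [q]surjective_pairing e1 e2.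
  rewrite big1 // => q /eqP qg.
  case: eqP => [e1|]; last by rewrite pure0l.
  case: eqP => [e2|]; last by rewrite pure0r.
  by case/eqP: ne; rewrite -qg e1 e2 -conjMg pg.
by case: ifP => _; [rewrite dtens_actE | rewrite big1].
Qed.

Definition dtens (X Y : dmod) : dmod :=
  build_dmod (@dtens1_subproof X Y) (@dtensM_subproof X Y).


Definition ddual_act (X : dmod) : 'Hom(D, 'End('Hom(X, k^o))) :=
  linfun (fun x : D => linfun (fun phi : 'Hom(X, k^o) =>
    (phi \o dact X (antipode k H x))%VF)).

Lemma ddual_actE (X : dmod) x (phi : 'Hom(X, k^o)) v :
  ddual_act X x phi v = phi (dact X (antipode k H x) v).
Proof.
have l1 y : linear (fun phi : 'Hom(X, k^o) => (phi \o dact X (antipode k H y))%VF).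
  by move=> a f f'; rewrite comp_lfunDl -comp_lfunZl.
rewrite /ddual_act linfunE; first by rewrite (linfunE (l1 _)) comp_lfunE.
move=> a y z; apply/lfunP=> psi; rewrite add_lfunE scale_lfunE !(linfunE (l1 _)).
by rewrite !linearP /= comp_lfunDr -comp_lfunZr.
Qed.

Lemma antipodeE g h :
  antipode k H (e_ g h) = e_ (h^-1 * g^-1 * h)%g h^-1%g.
Proof. exact: dliftE. Qed.

Lemma ddual1_subproof (X : dmod) phi : \sum_g ddual_act X (e_ g 1%g) phi = phi.
Proof.
apply/lfunP=> v; rewrite sum_lfunE -[in RHS](dact1E v) linear_sum /=.
rewrite [RHS](reindex_inj invg_inj) /=; apply: eq_bigr => g _.
by rewrite ddual_actE antipodeE !(invg1, mul1g, mulg1).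
Qed.

Lemma ddualM_subproof (X : dmod) g h g' h' phi :
  ddual_act X (e_ g h) (ddual_act X (e_ g' h') phi) =
    if g == (h * g' * h^-1)%g then ddual_act X (e_ g (h * h')%g) phi else 0.
Proof.
apply/lfunP=> v; rewrite !ddual_actE !antipodeE dactME.
have -> : (h'^-1 * g'^-1 * h' == h'^-1 * (h^-1 * g^-1 * h) * h'^-1^-1)%g
          = (g == h * g' * h^-1)%g.
  rewrite invgK (inj_eq (mulIg _)) (inj_eq (mulgI _)).
  rewrite -(inj_eq (mulgI h)) -(inj_eq (mulIg h^-1%g)) eq_sym.
  rewrite !mulgA mulgV mul1g mulgK -(inj_eq invg_inj).
  by rewrite !invMg !invgK !mulgA.
case: eqP => [->|_]; last by rewrite linear0 zero_lfunE.
rewrite ddual_actE antipodeE !invMg !invgK !mulgA.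
by rewrite !(mulgKV, mulgK).
Qed.

Definition ddual (X : dmod) : dmod :=
  build_dmod (@ddual1_subproof X) (@ddualM_subproof X).

Lemma dtmor_subproof (X X' Y Y' : dmod) (f : dHom X X') (g : dHom Y Y') :
  tmap (vsval f) (vsval g) \in dhom (dtens X Y) (dtens X' Y').
Proof.
apply: dhom_basisP => x h; elim/tens_ind => [u v|s t Es Et]; last first.
  by rewrite !linearD /= Es Et.
rewrite tmapE /= !dtens_actE linear_sum /=; apply: eq_bigr => p _.
by rewrite tmapE (dhomP _ (subvsP f)) (dhomP _ (subvsP g)).
Qed.

Section Structure.
Variables X Y Z : dmod.

Definition dasc_map : 'Hom(tens (tens X Y) Z, tens X (tens Y Z)) :=
  tlift (fun t z => tlift (fun x y => pure x (pure y z)) t).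

Definition dascI_map : 'Hom(tens X (tens Y Z), tens (tens X Y) Z) :=
  tlift (fun x t => tlift (fun y z => pure (pure x y) z) t).

Definition dlun_map : 'Hom(tens k^o X, X) := tlift (fun (a : k^o) x => a *: x).
Definition dlunI_map : 'Hom(X, tens k^o X) := linfun (fun x => pure (1 : k^o) x).
Definition drun_map : 'Hom(tens X k^o, X) := tlift (fun x (a : k^o) => a *: x).
Definition drunI_map : 'Hom(X, tens X k^o) := linfun (fun x => pure x (1 : k^o)).

(* The braiding is x (x) y |-> R (y (x) x) = flip (R_21 (x (x) y)): R_21, and *)
(* not R, intertwines this coproduct with its opposite. The map               *)
(* x (x) y |-> flip (R (x (x) y)) sends the degrees (a, b) to (b, b a b^-1),  *)
(* whose product is not ab in general, so it need not be D(H)-linear.         *)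
Definition dbrd_map : 'Hom(tens X Y, tens Y X) :=
  tlift (fun x y => dact2 Y X (Rmx k H) (pure y x)).

Definition dev_map : 'Hom(tens 'Hom(X, k^o) X, k^o) :=
  tlift (fun (phi : 'Hom(X, k^o)) x => phi x).

Definition dcoord (i : 'I_(\dim {:X})) : 'Hom(X, k^o) :=
  linfun (fun x => coord (vbasis fullv) i x : k^o).

Definition dcoev_map : 'Hom(k^o, tens X 'Hom(X, k^o)) :=
  linfun (fun a : k^o =>
    (a : k) *: \sum_(i < \dim {:X}) pure ((vbasis fullv)`_i : X) (dcoord i)).

Definition dpiv_map : 'Hom(X, 'Hom('Hom(X, k^o), k^o)) :=
  linfun (fun x => linfun (fun phi : 'Hom(X, k^o) => phi x)).

Definition dpivI_map : 'Hom('Hom('Hom(X, k^o), k^o), X) :=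
  linfun (fun psi : 'Hom('Hom(X, k^o), k^o) =>
    \sum_(i < \dim {:X}) (psi (dcoord i) : k) *: ((vbasis fullv)`_i : X)).

Lemma dasc_mapE x y z :
  dasc_map (pure (pure x y) z) = pure x (pure y z).
Proof.
have [pl pr] := @pure_bilin k Y Z.
have [ql qr] := @pure_bilin k X (tens Y Z).
have b (z' : Z) : bilin (fun (x : X) (y : Y) => pure x (pure y z')).
  by split=> w a s t; rewrite ?ql ?pl ?qr.
rewrite /dasc_map tliftE ?tliftE //; split=> [w a s t|w a s t].
  by rewrite linearP.
elim/tens_ind: w => [u v|w w' E E']; first by rewrite !tliftE // pr qr.
by rewrite !linearD /= E E' addrACA.
Qed.

Lemma dascI_mapE x y z :
  dascI_map (pure x (pure y z)) = pure (pure x y) z.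
Proof.
have [pl pr] := @pure_bilin k X Y.
have [ql qr] := @pure_bilin k (tens X Y) Z.
have b (x' : X) : bilin (fun (y : Y) (z : Z) => pure (pure x' y) z).
  by split=> w a s t; rewrite ?pr ?ql ?qr.
rewrite /dascI_map tliftE ?tliftE //; split=> [w a s t|w a s t].
  elim/tens_ind: w => [u v|w w' E E']; first by rewrite !tliftE // pl ql.
  by rewrite !linearD /= E E' addrACA.
by rewrite linearP.
Qed.

Lemma dlun_mapE a x : dlun_map (pure a x) = (a : k) *: x.
Proof.
rewrite /dlun_map tliftE //; split=> w b s t; first by rewrite scalerDl -scalerA.
by rewrite scalerDr !scalerA mulrC.
Qed.

Lemma drun_mapE x a : drun_map (pure x a) = (a : k) *: x.
Proof.
rewrite /drun_map tliftE //; split=> w b s t; last by rewrite scalerDl -scalerA.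
by rewrite scalerDr !scalerA mulrC.
Qed.

Lemma dlunI_mapE x : dlunI_map x = pure (1 : k^o) x.
Proof. by have [_ pr] := @pure_bilin k k^o X; rewrite /dlunI_map linfunE. Qed.

Lemma drunI_mapE x : drunI_map x = pure x (1 : k^o).
Proof. by have [pl _] := @pure_bilin k X k^o; rewrite /drunI_map linfunE. Qed.

Lemma dbrd_mapE x y :
  dbrd_map (pure x y) =
    \sum_g pure (dact Y (gdbl k g) y) (dact X (e_ g 1%g) x).
Proof.
have [pl pr] := @pure_bilin k Y X.
rewrite /dbrd_map tliftE; last by split=> w a s t; rewrite ?pl ?pr linearP.
rewrite linear_sum sum_lfunE; apply: eq_bigr => g _; exact: dact2E.
Qed.

Lemma dev_mapE phi x : dev_map (pure phi x) = phi x.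
Proof.
rewrite /dev_map tliftE //; split=> w a s t; last by rewrite linearP.
by rewrite add_lfunE scale_lfunE.
Qed.

Lemma dcoordE i x : dcoord i x = coord (vbasis fullv) i x.
Proof. by rewrite /dcoord linfunE // => a u v; rewrite linearP. Qed.

Lemma dcoev_mapE a :
  dcoev_map a = (a : k) *: \sum_(i < \dim {:X}) pure ((vbasis fullv)`_i : X) (dcoord i).
Proof.
by rewrite /dcoev_map linfunE // => b s t; rewrite scalerDl -scalerA.
Qed.

Lemma dpiv_mapE x phi : dpiv_map x phi = phi x.
Proof.
have l y : linear (fun phi : 'Hom(X, k^o) => phi y).
  by move=> a f g; rewrite add_lfunE scale_lfunE.
rewrite /dpiv_map linfunE; first by rewrite linfunE.
move=> a s t; apply/lfunP=> psi.
by rewrite add_lfunE scale_lfunE !linfunE // linearP.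
Qed.

Lemma dpivI_mapE psi :
  dpivI_map psi = \sum_(i < \dim {:X}) (psi (dcoord i) : k) *: ((vbasis fullv)`_i : X).
Proof.
rewrite /dpivI_map linfunE // => a s t; rewrite scaler_sumr -big_split /=.
by apply: eq_bigr => i _; rewrite add_lfunE scale_lfunE scalerDl scalerA.
Qed.

Lemma dpivK x : dpivI_map (dpiv_map x) = x.
Proof.
rewrite dpivI_mapE [RHS](coord_vbasis (memvf x)); apply: eq_bigr => i _.
by rewrite dpiv_mapE dcoordE.
Qed.

Lemma dpivIK psi : dpiv_map (dpivI_map psi) = psi.
Proof.
apply/lfunP=> phi; rewrite dpiv_mapE dpivI_mapE.
have {2}-> : phi = \sum_(i < \dim {:X}) (phi (vbasis fullv)`_i : k) *: dcoord i.
  apply/lfunP=> v; rewrite sum_lfunE [in LHS](coord_vbasis (memvf v)).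
  rewrite linear_sum; apply: eq_bigr => i _.
  by rewrite scale_lfunE dcoordE linearZ /= /GRing.scale /= mulrC.
rewrite !linear_sum /=; apply: eq_bigr => i _.
by rewrite !linearZ /= /GRing.scale /= mulrC.
Qed.

End Structure.

Lemma gdblE (X : dmod) g (v : X) :
  dact X (gdbl k g) v = \sum_x dact X (e_ x g) v.
Proof. by rewrite /gdbl linear_sum sum_lfunE. Qed.

Lemma gdbl_dbl a x h (X : dmod) (v : X) :
  dact X (gdbl k a) (dact X (e_ x h) v) =
    dact X (e_ (a * x * a^-1)%g (a * h)%g) v.
Proof.
rewrite /gdbl linear_sum sum_lfunE (bigD1 (a * x * a^-1)%g) //= big1 ?addr0.
  by rewrite dactME eqxx.
by move=> g gn; rewrite dactME (negPf gn).
Qed.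

Lemma dbl_gdbl a x h (X : dmod) (v : X) :
  dact X (e_ x h) (dact X (gdbl k a) v) = dact X (e_ x (h * a)%g) v.
Proof.
rewrite gdblE linear_sum (bigD1 (x ^ h)%g) //=.
rewrite big1 ?addr0.
  by rewrite dactME conjgE !mulgA mulgK mulgV mul1g eqxx.
move=> g gn; rewrite dactME; case: eqP => // e; case/eqP: gn.
by rewrite e conjgE !mulgA mulVg mul1g mulgKV.
Qed.

Lemma dhom_inv (X Y : dmod) (f : 'Hom(X, Y)) (g : 'Hom(Y, X)) :
  f \in dhom X Y -> cancel f g -> cancel g f -> g \in dhom Y X.
Proof.
move=> fH fK gK; apply/dhomP=> x v.
by rewrite -[v in LHS]gK -(dhomP _ fH) fK.
Qed.

Lemma dasc_subproof (X Y Z : dmod) :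
  dasc_map X Y Z \in dhom (dtens (dtens X Y) Z) (dtens X (dtens Y Z)).
Proof.
apply: dhom_basisP => x h; elim/tens_ind => [t w|s t Es Et]; last first.
  by rewrite !linearD /= Es Et.
elim/tens_ind: t => [u v|s t Es Et]; last first.
  have [pl _] := @pure_bilin k (tens X Y) Z.
  by rewrite -[s]scale1r pl scale1r !linearD /= Es Et.
rewrite dasc_mapE /= (dtens_actE (X := dtens X Y)) linear_sum /=.
rewrite (dtens_actE (Y := dtens Y Z)).
pose F a b c : tens X (tens Y Z) := pure (dact X (e_ a h) u)
  (pure (dact Y (e_ b h) v) (dact Z (e_ c h) w)).
transitivity (\sum_(p : H * H | (p.1 * p.2)%g == x)
   \sum_(q : H * H | (q.1 * q.2)%g == p.1) F q.1 q.2 p.2).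
  apply: eq_bigr => p _; rewrite /= dtens_actE pure_suml linear_sum /=.
  by apply: eq_bigr => q _; rewrite dasc_mapE.
transitivity (\sum_(p : H * H | (p.1 * p.2)%g == x)
   \sum_(q : H * H | (q.1 * q.2)%g == p.2) F p.1 q.1 q.2); last first.
  by apply: eq_bigr => p _; rewrite /= dtens_actE pure_sumr.
rewrite !pair_big_dep /=.
pose f (r : (H * H) * (H * H)) := ((r.1.1 * r.2.1, r.2.2), (r.1.1, r.2.1))%g.
pose g (r : (H * H) * (H * H)) := ((r.2.1, r.2.2 * r.1.2), (r.2.2, r.1.2))%g.
rewrite (reindex_onto f g) /=; last first.
  by move=> [[a b] [c d]] /= /andP[_ /eqP e]; rewrite /f /g /= e.
apply: eq_bigl => -[[a b] [c d]]; rewrite /f /g /= eqxx andbT !xpair_eqE !eqxx.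
by rewrite !andbT; case: ((c * d)%g =P b) => [<-|_]; rewrite ?andbF // mulgA.
Qed.

Lemma dascK (X Y Z : dmod) : cancel (dasc_map X Y Z) (dascI_map X Y Z).
Proof.
elim/tens_ind=> [t z|s t Es Et]; last by rewrite !linearD /= Es Et.
elim/tens_ind: t => [u v|s t Es Et]; first by rewrite dasc_mapE dascI_mapE.
have [pl _] := @pure_bilin k (tens X Y) Z.
by rewrite -[s]scale1r pl scale1r !linearD /= Es Et.
Qed.

Lemma dascIK (X Y Z : dmod) : cancel (dascI_map X Y Z) (dasc_map X Y Z).
Proof.
elim/tens_ind=> [u t|s t Es Et]; last by rewrite !linearD /= Es Et.
elim/tens_ind: t => [v w|s t Es Et]; first by rewrite dascI_mapE dasc_mapE.
have [_ pr] := @pure_bilin k X (tens Y Z).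
by rewrite -[s]scale1r pr scale1r !linearD /= Es Et.
Qed.

Lemma dascI_subproof (X Y Z : dmod) :
  dascI_map X Y Z \in dhom (dtens X (dtens Y Z)) (dtens (dtens X Y) Z).
Proof.
apply: dhom_inv (dasc_subproof X Y Z) _ _; [exact: dascK | exact: dascIK].
Qed.

Lemma pure_scaler (U V : vectType k) (u : U) a (v : V) :
  pure u (a *: v) = a *: (pure u v : tens U V).
Proof.
have [_ pr] := @pure_bilin k U V.
by rewrite -[a *: v]addr0 pr pure0r addr0.
Qed.

Lemma pure_scalel (U V : vectType k) (u : U) a (v : V) :
  pure (a *: u) v = a *: (pure u v : tens U V).
Proof.
have [pl _] := @pure_bilin k U V.
by rewrite -[a *: u]addr0 pl pure0l addr0.
Qed.

Lemma dlun_subproof (X : dmod) : dlun_map X \in dhom (dtens dunit X) X.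
Proof.
apply: dhom_basisP => x h; elim/tens_ind => [a v|s t Es Et]; last first.
  by rewrite !linearD /= Es Et.
rewrite dlun_mapE linearZ /= (dtens_actE (X := dunit)) linear_sum /= (bigD1 (1%g, x)) /=.
  rewrite dlun_mapE dunit_actE counitE eqxx scale1r big1 ?addr0 //.
  move=> -[b c] /= /andP[/eqP <-]; rewrite xpair_eqE.
  rewrite dlun_mapE dunit_actE counitE; case: eqP => [->|]; last first.
    by rewrite !scale0r.
  by rewrite mul1g eqxx.
by rewrite mul1g.
Qed.

Lemma drun_subproof (X : dmod) : drun_map X \in dhom (dtens X dunit) X.
Proof.
apply: dhom_basisP => x h; elim/tens_ind => [v a|s t Es Et]; last first.
  by rewrite !linearD /= Es Et.
rewrite drun_mapE linearZ /= (dtens_actE (Y := dunit)) linear_sum /= (bigD1 (x, 1%g)) /=.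
  rewrite drun_mapE dunit_actE counitE eqxx scale1r big1 ?addr0 //.
  move=> -[b c] /= /andP[/eqP <-]; rewrite xpair_eqE.
  rewrite drun_mapE dunit_actE counitE andbC; case: eqP => [->|]; last first.
    by rewrite !scale0r.
  by rewrite mulg1 eqxx.
by rewrite mulg1.
Qed.

Lemma dlunI_subproof (X : dmod) : dlunI_map X \in dhom X (dtens dunit X).
Proof.
apply: dhom_inv (dlun_subproof X) _ _.
  elim/tens_ind=> [a v|s t Es Et]; last by rewrite !linearD /= Es Et.
  rewrite dlun_mapE linearZ /= dlunI_mapE -pure_scalel.
  by rewrite /GRing.scale /= mulr1.
by move=> v; rewrite dlunI_mapE dlun_mapE scale1r.
Qed.

Lemma drunI_subproof (X : dmod) : drunI_map X \in dhom X (dtens X dunit).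
Proof.
apply: dhom_inv (drun_subproof X) _ _.
  elim/tens_ind=> [v a|s t Es Et]; last by rewrite !linearD /= Es Et.
  rewrite drun_mapE linearZ /= drunI_mapE -pure_scaler.
  by rewrite /GRing.scale /= mulr1.
by move=> v; rewrite drunI_mapE drun_mapE scale1r.
Qed.

Lemma dbrd_subproof (X Y : dmod) :
  dbrd_map X Y \in dhom (dtens X Y) (dtens Y X).
Proof.
apply: dhom_basisP => x h; elim/tens_ind => [u v|s t Es Et]; last first.
  by rewrite !linearD /= Es Et.
rewrite dbrd_mapE /= dtens_actE !linear_sum /=.
transitivity (\sum_(p : H * H | (p.1 * p.2)%g == x)
  pure (dact Y (e_ (p.1 * p.2 * p.1^-1)%g (p.1 * h)%g) v)
       (dact X (e_ p.1 h) u)).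
  apply: eq_bigr => p _; rewrite dbrd_mapE (bigD1 p.1) //= big1 ?addr0.
    by rewrite gdbl_dbl dactME !(mul1g, mulg1, invg1) eqxx.
  move=> g gn; rewrite dactME !(mul1g, mulg1, invg1) (negPf gn).
  by rewrite pure0r.
under [RHS]eq_bigr do rewrite dtens_actE.
rewrite [RHS]exchange_big /=.
transitivity (\sum_(q : H * H | (q.1 * q.2)%g == x)
  pure (dact Y (e_ q.1 (q.2 * h)%g) v) (dact X (e_ q.2 h) u)); last first.
  apply: eq_bigr => q _; rewrite (bigD1 (q.2 ^ h)%g) //= big1 ?addr0.
    rewrite dbl_gdbl dactME conjgE mulg1.
    by rewrite !mulgA mulgK mulgV mul1g eqxx.
  move=> g gn; rewrite dactME; case: eqP => [e|_]; last by rewrite pure0r.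
  by case/eqP: gn; rewrite e conjgE !mulgA mulVg mul1g mulgKV.
pose f (q : H * H) := (q.2, q.2^-1 * q.1 * q.2)%g.
pose g (p : H * H) := (p.1 * p.2 * p.1^-1, p.1)%g.
rewrite (reindex_onto f g) /= => [|[a b] _]; last first.
  by rewrite /f /g /= !mulgA mulgKV mulVg mul1g.
have E (a b : H) : (b * (b^-1 * a * b) * b^-1)%g = a.
  by rewrite !mulgA mulgV mul1g mulgK.
apply: eq_big => [[a b]|[a b] _] /=; last by rewrite E.
by rewrite /g /= E eqxx andbT !mulgA mulgV mul1g.
Qed.

Lemma dev_subproof (X : dmod) : dev_map X \in dhom (dtens (ddual X) X) dunit.
Proof.
apply: dhom_basisP => x h; elim/tens_ind => [phi v|s t Es Et]; last first.
  by rewrite !linearD /= Es Et.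
rewrite dev_mapE /= dunit_actE counitE (dtens_actE (X := ddual X)) linear_sum /=.
transitivity (\sum_(p : H * H | (p.1 * p.2)%g == x)
   if p.2 == (p.1^-1)%g then phi (dact X (e_ (p.2 ^ h)%g 1%g) v) else 0).
  apply: eq_bigr => p _; rewrite dev_mapE ddual_actE antipodeE dactME.
  rewrite invgK mulVg -mulgA -[in X in _ == X]mulgA.
  rewrite (inj_eq (mulgI _)) (inj_eq (mulIg _)) eq_sym.
  by case: eqP => [->|_]; [rewrite conjgE mulgA | rewrite linear0].
have [->|xn1] := eqVneq x 1%g; last first.
  rewrite scale0r big1 // => p /eqP px; case: eqP => // e.
  by case/eqP: xn1; rewrite -px e mulgV.
rewrite scale1r -[in RHS](dact1E v) linear_sum /=.
rewrite (reindex_onto (fun g : H => (g^-1, g)%g) snd) /=; last first.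
  by move=> [a b] /=; rewrite -eq_invg_mul => /eqP <-; rewrite invgK.
rewrite [RHS](reindex_inj (conjg_inj h)) /=.
by apply: eq_big => [g|g _]; rewrite ?mulVg ?invgK !eqxx.
Qed.

Lemma dcoev_slide (X : dmod) (A B : 'End(X)) (Bt : 'End('Hom(X, k^o))) :
  (forall phi v, Bt phi v = phi (B v)) ->
  \sum_(i < \dim {:X}) (pure (A (vbasis fullv)`_i) (Bt (dcoord i))
                          : tens X 'Hom(X, k^o)) =
  \sum_(i < \dim {:X}) pure (A (B (vbasis fullv)`_i)) (dcoord i).
Proof.
move=> BtE; pose b (i : nat) := (vbasis (fullv : {vspace X}))`_i.
have E (i : 'I_(\dim {:X})) : Bt (dcoord i) =
    \sum_(j < \dim {:X}) (coord (vbasis fullv) i (B (b j)) : k) *: dcoord j.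
  apply/lfunP=> v; rewrite BtE sum_lfunE dcoordE.
  rewrite [v in LHS](coord_vbasis (memvf v)) !linear_sum /=.
  apply: eq_bigr => j _; rewrite !linearZ /= scale_lfunE dcoordE.
  by rewrite /GRing.scale /= mulrC.
under eq_bigr do rewrite E pure_sumr.
rewrite exchange_big /=; apply: eq_bigr => j _.
rewrite [B _ in RHS](coord_vbasis (memvf _)) linear_sum /= pure_suml.
by apply: eq_bigr => i _; rewrite pure_scaler linearZ /= pure_scalel.
Qed.

Lemma dcoev_subproof (X : dmod) :
  dcoev_map X \in dhom dunit (dtens X (ddual X)).
Proof.
apply: dhom_basisP => x h a; rewrite !dcoev_mapE linearZ /=.
rewrite dunit_actE counitE [X in X *: _]mulrC -scalerA; congr (_ *: _).
rewrite [RHS]linear_sum /=.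
under [RHS]eq_bigr do rewrite (dtens_actE (Y := ddual X)).
rewrite exchange_big /=.
transitivity (\sum_(p : H * H | (p.1 * p.2)%g == x)
  \sum_(i < \dim {:X}) (pure (if p.1 == (p.2^-1)%g then
     dact X (e_ p.1 1%g) (vbasis fullv)`_i else 0) (dcoord i)
     : tens X 'Hom(X, k^o))); last first.
  apply: eq_bigr => p _.
  rewrite (dcoev_slide _ (B := dact X (antipode k H (e_ p.2 h)))); last first.
    by move=> phi v; rewrite ddual_actE.
  apply: eq_bigr => i _; rewrite antipodeE dactME mulgV.
  by rewrite !mulgA mulgV mul1g mulgK.
rewrite exchange_big /=; have [->|xn1] := eqVneq x 1%g; last first.
  rewrite scale0r big1 // => i _; rewrite big1 // => p /eqP px.
  case: eqP => [e|_]; last by rewrite pure0l.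
  by case/eqP: xn1; rewrite -px e mulVg.
rewrite scale1r; apply: eq_bigr => i _.
rewrite -[in LHS](dact1E (vbasis _)`_i) pure_suml.
rewrite [RHS](reindex_onto (fun g : H => (g, g^-1)%g) fst) /=; last first.
  by move=> [b c] /=; rewrite -eq_invg_mul => /eqP <-.
by apply: eq_big => [g|g _]; rewrite ?mulgV ?invgK !eqxx.
Qed.

Lemma dpiv_subproof (X : dmod) : dpiv_map X \in dhom X (ddual (ddual X)).
Proof.
apply: dhom_basisP => x h v; apply/lfunP=> phi.
rewrite /= (ddual_actE (X := ddual X)) !dpiv_mapE /= ddual_actE !antipodeE.
by rewrite !(invMg, invgK) !mulgA mulgV mul1g mulgK.
Qed.

Lemma dpivI_subproof (X : dmod) : dpivI_map X \in dhom (ddual (ddual X)) X.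
Proof.
apply: dhom_inv (dpiv_subproof X) _ _; [exact: dpivK | exact: dpivIK].
Qed.

Definition double_mod : bpdata k :=
  @BPData k dmod dHom
    (fun X => dmorph (did_subproof X))
    (fun X Y Z g f => dmorph (dcomp_subproof g f))
    dunit dtens
    (fun X X' Y Y' f g => dmorph (dtmor_subproof f g))
    (fun X Y Z => dmorph (dasc_subproof X Y Z))
    (fun X Y Z => dmorph (dascI_subproof X Y Z))
    (fun X => dmorph (dlun_subproof X))
    (fun X => dmorph (dlunI_subproof X))
    (fun X => dmorph (drun_subproof X))
    (fun X => dmorph (drunI_subproof X))
    (fun X Y => dmorph (dbrd_subproof X Y))
    ddual
    (fun X => dmorph (dev_subproof X))
    (fun X => dmorph (dcoev_subproof X))
    (fun X => dmorph (dpiv_subproof X))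
    (fun X => dmorph (dpivI_subproof X)).

(* The one-dimensional module V_{z,1}, for z central. *)
Section CentralModule.
Variable z : H.
Hypothesis zZ : z \in 'Z([set: H])%g.

Definition dcent_act : 'Hom(D, 'End(k^o)) :=
  dlift (fun g _ : H => (g == z)%:R *: \1%VF).

Lemma dcent_actE g h v : dcent_act (e_ g h) v = (g == z)%:R *: v.
Proof. by rewrite dliftE scale_lfunE id_lfunE. Qed.

Lemma dcent1_subproof v : \sum_g dcent_act (e_ g 1%g) v = v.
Proof.
rewrite (bigD1 z) //= dcent_actE eqxx scale1r big1 ?addr0 // => g gz.
by rewrite dcent_actE (negPf gz) scale0r.
Qed.

Lemma dcentM_subproof g h g' h' v :
  dcent_act (e_ g h) (dcent_act (e_ g' h') v) =
    if g == (h * g' * h^-1)%g then dcent_act (e_ g (h * h')%g) v else 0.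
Proof.
have zc x : (x * z = z * x)%g.
  by have /centerP[_ /(_ x (in_setT x))] := zZ.
rewrite !dcent_actE; have [->|] := eqVneq g z; last first.
  by rewrite !scale0r if_same.
rewrite scale1r; have [->|g'z] := eqVneq g' z.
  by rewrite zc mulgK eqxx scale1r.
case: eqP => [e|_]; last by rewrite scale0r.
by case/eqP: g'z; apply: (mulgI h); rewrite zc e mulgKV.
Qed.

Definition dcent : dmod := build_dmod dcent1_subproof dcentM_subproof.
End CentralModule.

End Modules.

Section Grading.
Variables (k : fieldType) (A Gt : finGroupType).
Variable i : {morphism [set: A] >-> Gt}.
Hypothesis iZ : (i @* [set: A])%g \subset 'Z([set: Gt])%g.

Lemma morph_central a : i a \in 'Z([set: Gt])%g.
Proof. by apply: (subsetP iZ); rewrite mem_morphim ?inE. Qed.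

(* X has degree alpha, for alpha : A -> k^* a character of A. *)
Definition has_degree (alpha : A -> k) (X : Obj (double_mod k Gt)) : Prop :=
  forall a : A,
    let V : Obj (double_mod k Gt) := dcent k (morph_central a) in
    (brd X V ∘ brd V X)%cat = alpha a *: idm (tobj V X).

Definition has_trivial_degree := has_degree (fun=> 1).

Lemma double_braidingE z (zZ : z \in 'Z([set: Gt])%g) (X : dmod k Gt) w x :
  let V := dcent k zZ in
  dbrd_map X V (dbrd_map V X (pure w x)) = pure w (dact X (gdbl k z) x).
Proof.
move=> V; rewrite (dbrd_mapE (X := V)) (bigD1 z) //= big1 ?addr0; last first.
  by move=> g gz; rewrite dcent_actE (negPf gz) scale0r pure0r.
rewrite dcent_actE eqxx scale1r (dbrd_mapE (Y := V)) /=.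
have E g : dcent_act k z (gdbl k g) w = w.
  rewrite /gdbl linear_sum sum_lfunE (bigD1 z) //= dcent_actE eqxx scale1r.
  by rewrite big1 ?addr0 // => x0 xz; rewrite dcent_actE (negPf xz) scale0r.
under eq_bigr do rewrite E.
by rewrite -pure_sumr dact1E.
Qed.

Lemma trivial_degreeP (X : dmod k Gt) :
  has_trivial_degree X <->
  (forall a (v : X), dact X (gdbl k (i a)) v = v).
Proof.
split=> [deg a v|deg a]; last first.
  apply: val_inj => /=; rewrite scale1r; apply: tens_ext => w x.
  by rewrite comp_lfunE double_braidingE deg id_lfunE.
have /(congr1 vsval) /lfunP /(_ (pure (1 : k^o) v)) := deg a.
rewrite /= scale1r comp_lfunE double_braidingE id_lfunE.
by move=> /(congr1 (dlun_map X)); rewrite !dlun_mapE !scale1r.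
Qed.

Lemma trivial_degree_unit : has_trivial_degree (dunit k Gt).
Proof.
apply/trivial_degreeP=> a v; rewrite gdblE (bigD1 1%g) //=.
rewrite dunit_actE counitE eqxx scale1r big1 ?addr0 // => x xn.
by rewrite dunit_actE counitE (negPf xn) scale0r.
Qed.

Lemma trivial_degree_tens (X Y : dmod k Gt) :
  has_trivial_degree X -> has_trivial_degree Y ->
  has_trivial_degree (dtens X Y).
Proof.
move=> /trivial_degreeP dX /trivial_degreeP dY; apply/trivial_degreeP=> a.
elim/tens_ind=> [u v|s t Es Et]; last by rewrite linearD /= Es Et.
rewrite -[u in RHS](dX a) -[v in RHS](dY a) !gdblE pure_suml.
under [RHS]eq_bigr do rewrite pure_sumr.
rewrite pair_big /= [RHS](partition_big (fun p => (p.1 * p.2)%g) xpredT) //=.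
by apply: eq_bigr => g _; rewrite dtens_actE.
Qed.

Lemma trivial_degree_dual (X : dmod k Gt) :
  has_trivial_degree X -> has_trivial_degree (ddual X).
Proof.
move=> /trivial_degreeP dX; apply/trivial_degreeP=> a phi; apply/lfunP=> v.
rewrite gdblE sum_lfunE -[in RHS](dX a^-1%g v) gdblE linear_sum /=.
rewrite [RHS](reindex_inj invg_inj) /=.
rewrite [RHS](reindex_inj (conjg_inj (i a))) /=.
apply: eq_bigr => x _; rewrite ddual_actE antipodeE conjgE !invMg !invgK.
by rewrite morphV ?inE ?mulgA.
Qed.

Definition trivial_component : bpdata k :=
  @full_sub k (double_mod k Gt) has_trivial_degree
    trivial_degree_unit
    trivial_degree_tens trivial_degree_dual.

End Grading.

(* Main.v *)
(* The functor from the trivial component to D(G)-mod keeps the underlying    *)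
(* vector space: on a D(Gt)-module X on which A acts trivially, a lift of h   *)
(* to Gt acts independently of the lift, and e_g acts as the sum of the e_x   *)
(* with pi(x) = g. The braiding and the twist (which acts as the sum of the   *)
(* elements e_g g) are sums over the group, hence preserved on the nose. The  *)
(* functor is dominant since Y is a retract of the image of the module of all *)
(* functions Gt -> Y, graded by the argument: embed y as                      *)
(* x |-> e_{pi x} y / |ker pi| and retract by f |-> sum_x e_{pi x} (f x).     *)
(* Averaging over D(H) makes every morphism f satisfy f g f = f for some g;   *)
(* together with biproducts and splitting of idempotents this gives abelian   *)
(* and semisimple, and passes to full subcategories closed under retracts.    *)
(* The S-matrix of D(H)-mod is                                                *)
(* S_ij = sum_{g,h} chi_i(e_g h) chi_j(e_h g). If c S = 0, put                *)
(* phi = sum_i c_i chi_i; then sum_{g,h} phi(e_g h) e_h g is central and has  *)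
(* trace 0 on every simple module, so it is 0 by Schur's lemma, and c = 0 by  *)
(* orthogonality of the characters.                                           *)

From mathcomp Require Import all_boot all_order all_algebra all_fingroup.
From mathcomp Require Import all_solvable.
From mathcomp Require Import reals complex boolp.
Require Import Defs.

Set Implicit Arguments.
Unset Strict Implicit.
Unset Printing Implicit Defensive.

Import GRing.Theory Num.Theory passmx.
Local Open Scope ring_scope.

(** * Semisimple linear categories *)

(** A module has trivial degree exactly when every element of A acts on it as the identity
    ([trivial_degreeP]), so the group action factors through G ([pi_fiber_act]). Regrading along
    [pi] then gives a D(G)-module on the same vector space ([dpush]). The monoidal constraints of
    this functor are identity maps ([dact_push_tens]); the braiding and the twist are sums over Gt
    that regroup along the fibres of [pi] ([push_braided], [push_twist]). Every D(G)-module is a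
    retract of the image of a module of functions on Gt ([pull_retract]), which is dominance.

    It remains to see that both categories have the required structure. Coherence is checked on pure
    tensors. Semisimplicity is reduced to [split_regular]: every morphism has a pseudo-inverse and
    idempotents split. For D(H) the pseudo-inverse is an averaged linear one ([double_regular]).
    Abelianness, Schur's lemma and decomposition into simples are formal consequences
    ([split_regular_abelian], [schur_iso], [decomposes_all]), and the regular module bounds the
    number of simples ([double_generator]). All this is inherited by the trivial component, which is
    closed under sums and retracts ([full_sub_braided_spherical_fusion]).

    For modularity, the trace of the double braiding is a bilinear expression in characters
    ([rtrace_double_braiding]). A vector in the kernel of the S-matrix yields a central element with
    zero trace on all simples, hence zero ([central_zero]); orthogonality of characters ([chi_orth],
    [chi_orth_neq]) then kills the vector ([smatrix_unit]). *)

Section CategoryPredicates.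
Local Open Scope cat_scope.
Variables (k : fieldType) (C : bpdata k).

(** The form in which complete reducibility is used: [g ∘ f] and [f ∘ g] become idempotents, and
    splitting them produces kernels, cokernels and complements. *)
Definition von_neumann_regular :=
  forall (X Y : Obj C) (f : Hom X Y), exists g : Hom Y X, f ∘ g ∘ f = f.

Definition idempotents_split :=
  forall (X : Obj C) (e : Hom X X), e ∘ e = e ->
  exists Y (i : Hom Y X) (p : Hom X Y), p ∘ i = idm Y /\ i ∘ p = e.

Definition retract_of (Y X : Obj C) :=
  exists (i : Hom Y X) (p : Hom X Y), p ∘ i = idm Y.

Definition split_regular :=
  [/\ linear_category C, forall X Y : Obj C, has_biproduct X Y,
      von_neumann_regular & idempotents_split].

Definition has_generator :=
  exists G : Obj C, forall X : Obj C, idm X != 0 ->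
  exists f : Hom G X, f != 0.

End CategoryPredicates.

(** * Composition in linear categories *)

Section LinearCategories.
Local Open Scope cat_scope.
Variables (k : fieldType) (C : bpdata k).
Hypothesis Clin : linear_category C.
Implicit Types X Y Z W : Obj C.

Lemma compmA X Y Z W (h : Hom Z W) (g : Hom Y Z) (f : Hom X Y) :
  h ∘ (g ∘ f) = (h ∘ g) ∘ f.
Proof. by case: Clin. Qed.

Lemma comp1m X Y (f : Hom X Y) : idm Y ∘ f = f.
Proof. by case: Clin. Qed.

Lemma compm1 X Y (f : Hom X Y) : f ∘ idm X = f.
Proof. by case: Clin. Qed.

Lemma compm_linear X Y Z (g : Hom Y Z) : linear (fun f : Hom X Y => g ∘ f).
Proof. by case: Clin => _ _ _ H _ a f f'; apply: H. Qed.

Lemma compm_linearl X Y Z (f : Hom X Y) : linear (fun g : Hom Y Z => g ∘ f).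
Proof. by case: Clin => _ _ _ _ H a g g'; apply: H. Qed.

Lemma compmDr X Y Z (g : Hom Y Z) (f f' : Hom X Y) :
  g ∘ (f + f') = g ∘ f + g ∘ f'.
Proof. by have := compm_linear g 1 f f'; rewrite /= !scale1r. Qed.

Lemma compmDl X Y Z (f : Hom X Y) (g g' : Hom Y Z) :
  (g + g') ∘ f = g ∘ f + g' ∘ f.
Proof. by have := compm_linearl f 1 g g'; rewrite /= !scale1r. Qed.

Lemma compm0 X Y Z (g : Hom Y Z) : g ∘ (0 : Hom X Y) = 0.
Proof. by apply: (addIr (g ∘ 0)); rewrite -compmDr !add0r. Qed.

Lemma comp0m X Y Z (f : Hom X Y) : (0 : Hom Y Z) ∘ f = 0.
Proof. by apply: (addIr (0 ∘ f)); rewrite -compmDl !add0r. Qed.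

Lemma compmZr X Y Z (g : Hom Y Z) a (f : Hom X Y) : g ∘ (a *: f) = a *: (g ∘ f).
Proof. by have := compm_linear g a f 0; rewrite /= !addr0 compm0 addr0. Qed.

Lemma compmZl X Y Z (f : Hom X Y) a (g : Hom Y Z) : (a *: g) ∘ f = a *: (g ∘ f).
Proof. by have := compm_linearl f a g 0; rewrite /= !addr0 comp0m addr0. Qed.

Lemma compmBr X Y Z (g : Hom Y Z) (f f' : Hom X Y) :
  g ∘ (f - f') = g ∘ f - g ∘ f'.
Proof. by rewrite compmDr -scaleN1r compmZr scaleN1r. Qed.

Lemma compmBl X Y Z (f : Hom X Y) (g g' : Hom Y Z) :
  (g - g') ∘ f = g ∘ f - g' ∘ f.
Proof. by rewrite compmDl -scaleN1r compmZl scaleN1r. Qed.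

Lemma compm_sumr X Y Z (g : Hom Y Z) (I : finType) (f : I -> Hom X Y) :
  g ∘ (\sum_j f j) = \sum_j (g ∘ f j).
Proof.
rewrite -(linfunE (compm_linear g)) linear_sum /=.
by apply: eq_bigr => j _; rewrite linfunE //; exact: compm_linear.
Qed.

Lemma compm_suml X Y Z (f : Hom X Y) (I : finType) (g : I -> Hom Y Z) :
  (\sum_j g j) ∘ f = \sum_j (g j ∘ f).
Proof.
rewrite -(linfunE (compm_linearl f)) linear_sum /=.
by apply: eq_bigr => j _; rewrite linfunE //; exact: compm_linearl.
Qed.

Lemma zero_objP X : is_zero_obj X <-> idm X = 0.
Proof.
split=> [Z0|id0 Y]; first by case: (Z0 X).
by split=> f; [rewrite -(compm1 f) id0 compm0 | rewrite -(comp1m f) id0 comp0m].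
Qed.

Lemma mono_of_retraction X Y (i : Hom Y X) (p : Hom X Y) :
  p ∘ i = idm Y -> is_mono i.
Proof.
by move=> pi1 Z g h e; rewrite -(comp1m g) -pi1 -compmA e compmA pi1 comp1m.
Qed.

Lemma epi_of_section X Y (i : Hom Y X) (p : Hom X Y) :
  p ∘ i = idm Y -> is_epi p.
Proof.
by move=> pi1 Z g h e; rewrite -(compm1 g) -pi1 compmA e -compmA pi1 compm1.
Qed.

Lemma iso_eq1 X Y (i : Hom Y X) (p : Hom X Y) :
  is_iso i -> p ∘ i = idm Y -> i ∘ p = idm X.
Proof.
by case=> q [qi iq] pi1;
  rewrite -[RHS]iq -(compm1 i) -[q]comp1m -pi1 -!compmA iq compm1.
Qed.

Lemma isomorphic_sym X Y : isomorphic X Y -> isomorphic Y X.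
Proof. by case=> f [g [gf fg]]; exists g, f. Qed.

Lemma isomorphic_trans X Y Z :
  isomorphic X Y -> isomorphic Y Z -> isomorphic X Z.
Proof.
case=> f [g [gf fg]] [f' [g' [gf' fg']]]; exists (f' ∘ f), (g ∘ g').
split; rewrite -compmA.
  by rewrite (compmA g') gf' comp1m.
by rewrite (compmA f) fg comp1m.
Qed.

Lemma simple_id_neq0 X : simple_obj X -> idm X != 0.
Proof. by case=> nz _; apply/eqP=> /zero_objP. Qed.

End LinearCategories.

(** * Abelian structure, Schur's lemma and decomposition into simple objects *)

Section SplitRegular.
Local Open Scope cat_scope.
Variables (k : fieldType) (C : bpdata k).
Hypothesis Css : split_regular C.
Implicit Types X Y Z W : Obj C.

Let Clin : linear_category C. Proof. by case: Css. Qed.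
Let Creg : von_neumann_regular C. Proof. by case: Css. Qed.
Let Csplit : idempotents_split C. Proof. by case: Css. Qed.
Let cA := @compmA k C Clin.
Let c1m := @comp1m k C Clin.
Let cm1 := @compm1 k C Clin.
Let c0m := @comp0m k C Clin.
Let cm0 := @compm0 k C Clin.
Let cBl := @compmBl k C Clin.
Let cBr := @compmBr k C Clin.

Lemma mono_retraction X Y (f : Hom X Y) :
  is_mono f -> exists g : Hom Y X, g ∘ f = idm X.
Proof.
move=> mf; have [g fgf] := Creg f; exists g.
by apply: mf; rewrite cA fgf cm1.
Qed.

Lemma epi_section X Y (f : Hom X Y) :
  is_epi f -> exists g : Hom Y X, f ∘ g = idm Y.
Proof.
move=> ef; have [g fgf] := Creg f; exists g.
by apply: ef; rewrite fgf c1m.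
Qed.

Lemma complement_idem X (e : Hom X X) :
  e ∘ e = e -> (idm X - e) ∘ (idm X - e) = idm X - e.
Proof. by move=> ee; rewrite cBr cm1 cBl c1m ee subrr subr0. Qed.

(** The idempotent [g ∘ f] has the same kernel as [f], and the kernel of an idempotent is the image
    of the complementary one. *)
Lemma kernel_of_splitting X Y (f : Hom X Y) (g : Hom Y X) K
    (i : Hom K X) (p : Hom X K) :
  f ∘ g ∘ f = f -> p ∘ i = idm K -> i ∘ p = idm X - g ∘ f -> is_kernel i f.
Proof.
move=> fgf pi1 ipe; split=> [|Z h fh0].
  by rewrite -(cm1 i) -pi1 (cA i) ipe cA cBr cm1 cA fgf subrr c0m.
have ih : i ∘ (p ∘ h) = h by rewrite cA ipe cBl c1m -cA fh0 cm0 subr0.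
exists (p ∘ h); split=> // h' ih'.
by apply: (mono_of_retraction Clin pi1); rewrite ih.
Qed.

Lemma cokernel_of_splitting X Y (f : Hom X Y) (g : Hom Y X) Q
    (i : Hom Q Y) (p : Hom Y Q) :
  f ∘ g ∘ f = f -> p ∘ i = idm Q -> i ∘ p = idm Y - f ∘ g -> is_cokernel f p.
Proof.
move=> fgf pi1 ipe; split=> [|Z h hf0].
  by rewrite -(c1m p) -pi1 -(cA p) ipe -cA cBl c1m fgf subrr cm0.
have hp : h ∘ i ∘ p = h by rewrite -cA ipe cBr cm1 cA hf0 c0m subr0.
exists (h ∘ i); split=> // h' hp'.
by apply: (epi_of_section Clin pi1); rewrite hp.
Qed.

(** The image of the zero idempotent; it is taken on the unit, the one object sure to exist. *)
Lemma zero_obj_exists : exists Z : Obj C, is_zero_obj Z.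
Proof.
have [|Z [i [p [pi1 ip0]]]] := @Csplit 𝟙 0; first by rewrite cm0.
exists Z; apply/(zero_objP Clin).
have <- : p ∘ (i ∘ p) ∘ i = idm Z by rewrite cA pi1 c1m pi1.
by rewrite ip0 cm0 c0m.
Qed.

Lemma split_regular_abelian : abelian_category C.
Proof.
split.
- exact: zero_obj_exists.
- by case: Css.
- move=> X Y f; have [g fgf] := Creg f; split.
    have [|K [i [p [pi1 ipe]]]] := @Csplit X (idm X - g ∘ f).
      by apply: complement_idem; rewrite -(cA g) [f ∘ _]cA fgf.
    by exists K, i; apply: kernel_of_splitting fgf pi1 ipe.
  have [|Q [i [p [pi1 ipe]]]] := @Csplit Y (idm Y - f ∘ g).
    by apply: complement_idem; rewrite [_ ∘ (f ∘ g)]cA fgf.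
  by exists Q, p; apply: cokernel_of_splitting fgf pi1 ipe.
- move=> X Y f mf; have [g gf1] := mono_retraction mf.
  (* A split mono is the kernel of the idempotent complementary to its image; an idempotent has the
     identity as pseudo-inverse. *)
  exists Y, (idm Y - f ∘ g);
    apply: (kernel_of_splitting (g := idm Y) (p := g)) => //.
    by rewrite cm1 complement_idem // cA -(cA f) gf1 cm1.
  by rewrite c1m opprB addrC subrK.
- move=> X Y f ef; have [g fg1] := epi_section ef.
  exists X, (idm X - g ∘ f);
    apply: (cokernel_of_splitting (g := idm X) (i := g)) => //.
    by rewrite cm1 complement_idem // cA -(cA g) fg1 cm1.
  by rewrite cm1 opprB addrC subrK.
Qed.

Lemma simple_idem X (e : Hom X X) :
  simple_obj X -> e ∘ e = e -> e != 0 -> e = idm X.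
Proof.
case=> _ sX ee /eqP e0; have [Y [i [p [pi1 ipe]]]] := Csplit ee.
have [i0|iso] := sX _ _ (mono_of_retraction Clin pi1).
  by case: e0; rewrite -ipe i0 c0m.
by rewrite -ipe (iso_eq1 Clin iso pi1).
Qed.

(** With [g] a pseudo-inverse of [f], both composites are nonzero idempotents on simple objects,
    hence identities. *)
Lemma schur_iso X Y (f : Hom X Y) :
  simple_obj X -> simple_obj Y -> f != 0 -> is_iso f.
Proof.
move=> sX sY f0; have [g fgf] := Creg f; exists g; split.
  apply: (simple_idem sX); first by rewrite -(cA g) [f ∘ _]cA fgf.
  by apply: contraNneq f0 => gf0; rewrite -fgf -cA gf0 cm0.
apply: (simple_idem sY); first by rewrite cA fgf.
by apply: contraNneq f0 => fg0; rewrite -fgf fg0 c0m.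
Qed.

(** The map [a] to [i ∘ a ∘ p] embeds End Y in End X; if it reached [idm X], then [i ∘ p] would be
    [idm X]. This is the measure for the induction in [decomposes_all]. *)
Lemma dim_end_retract X Y (i : Hom Y X) (p : Hom X Y) :
  p ∘ i = idm Y -> i ∘ p <> idm X ->
  (\dim {: @Hom k C Y Y} < \dim {: @Hom k C X X})%N.
Proof.
move=> pi1 ip1; pose phi (a : Hom Y Y) := i ∘ a ∘ p.
have lphi : linear phi.
  by move=> c a b; rewrite /phi (compmDr Clin) (compmZr Clin) (compmDl Clin)
    (compmZl Clin).
have kphi : lker (linfun phi) == 0%VS.
  apply/lker0P=> a b; rewrite !linfunE // => ab.
  have E x : p ∘ phi x ∘ i = x.
    by rewrite /phi -!cA pi1 cm1 cA pi1 c1m.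
  by rewrite -(E a) -(E b) ab.
rewrite -(limg_dim_eq (f := linfun phi)) ?(eqP kphi) ?capv0 //.
rewrite ltnNge; apply/negP=> le.
have /eqP lf : (limg (linfun phi) == fullv)%VS by rewrite eqEdim subvf.
have /memv_imgP[a _ e] : idm X \in limg (linfun phi) by rewrite lf memvf.
apply: ip1; rewrite linfunE // in e.
by rewrite -[LHS]cm1 e /phi !cA -(cA i) pi1 cm1.
Qed.

(** Indexed by any finite type, so that two decompositions combine over the disjoint sum without
    arithmetic on ordinals. *)
Definition decomposes X := exists (I : finType) (S : I -> Obj C)
    (i : forall j, Hom (S j) X) (p : forall j, Hom X (S j)),
  [/\ forall j, simple_obj (S j),
      forall j, p j ∘ i j = idm (S j),
      forall j l, j != l -> p j ∘ i l = 0
    & \sum_j (i j ∘ p j) = idm X].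

Lemma decomposes_sum X : decomposes X -> sum_of_simples X.
Proof.
case=> I [S [i [p [S1 S2 S3 S4]]]].
exists #|I|, (fun j => S (enum_val j)), (fun j => i (enum_val j)),
  (fun j => p (enum_val j)); split=> //.
  by move=> j l jl; apply: S3; rewrite (inj_eq enum_val_inj).
by rewrite -S4 [RHS](big_enum_val (A := [pred _ | true])).
Qed.

Lemma decomposes_biproduct X Y1 Y2 (i1 : Hom Y1 X) (i2 : Hom Y2 X)
    (p1 : Hom X Y1) (p2 : Hom X Y2) :
  p1 ∘ i1 = idm Y1 -> p2 ∘ i2 = idm Y2 -> p1 ∘ i2 = 0 -> p2 ∘ i1 = 0 ->
  i1 ∘ p1 + i2 ∘ p2 = idm X -> decomposes Y1 -> decomposes Y2 -> decomposes X.
Proof.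
move=> p11 p22 p12 p21 e [I [S [i [p [S1 S2 S3 S4]]]]].
move=> [J [T [i' [p' [T1 T2 T3 T4]]]]].
pose U (j : I + J) := match j with inl a => S a | inr b => T b end.
pose iU j : Hom (U j) X :=
  match j with inl a => i1 ∘ i a | inr b => i2 ∘ i' b end.
pose pU j : Hom X (U j) :=
  match j with inl a => p a ∘ p1 | inr b => p' b ∘ p2 end.
have A V W W' (a : Hom V X) (b : Hom W V) (c : Hom X V) (d : Hom V W') :
  d ∘ c ∘ (a ∘ b) = d ∘ (c ∘ a) ∘ b by rewrite !cA.
exists (I + J)%type, U, iU, pU; split.
- by case=> ?; [exact: S1 | exact: T1].
- by case=> j; rewrite /= A ?p11 ?p22 cm1.
- case=> [j|j] [l|l] //= jl; last by rewrite A p22 cm1 T3.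
  + by rewrite A p11 cm1 S3.
  + by rewrite -cA [p1 ∘ _]cA p12 c0m cm0.
  + by rewrite -cA [p2 ∘ _]cA p21 c0m cm0.
rewrite big_sumType /= -e; congr (_ + _).
  rewrite -[in RHS](cm1 i1) -S4 (compm_sumr Clin) (compm_suml Clin).
  by apply: eq_bigr => j _; rewrite !cA.
rewrite -[in RHS](cm1 i2) -T4 (compm_sumr Clin) (compm_suml Clin).
by apply: eq_bigr => j _; rewrite !cA.
Qed.

(** Induction on the dimension of End X: a nonzero object that is not simple has a proper nonzero
    subobject, which is a direct summand, and both it and its complement have smaller endomorphism
    spaces. *)
Lemma decomposes_all X : decomposes X.
Proof.
have [n] := ubnP (\dim {: @Hom k C X X}); elim: n X => // n IH X leX.
have [X0|X0] := eqVneq (idm X) 0.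
  pose S (j : void) : Obj C := match j with end.
  exists void, S, (fun j : void => match j with end),
    (fun j : void => match j with end).
  by split=> [[]|[]|[]|]; rewrite big_pred0 ?X0 //; case.
have [[Y [f [mf f0 nf]]]|nY] := pselect (exists Y (f : Hom Y X),
    [/\ is_mono f, f <> 0 & ~ is_iso f]); last first.
  exists unit, (fun _ => X), (fun _ => idm X), (fun _ => idm X).
  split=> [_|_|[] []//|]; rewrite ?big_const ?card_unit ?cm1 //=.
    split=> [/(zero_objP Clin) e|Y f mf]; first by rewrite e eqxx in X0.
    have [|f0] := pselect (f = 0); first by left.
    have [|nf] := pselect (is_iso f); first by right.
    by case: nY; exists Y, f.
  by rewrite addr0.
have [g gf1] := mono_retraction mf.
have fg1 : f ∘ g <> idm X by move=> fg1; apply: nf; exists g.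
have fgfg : f ∘ g ∘ (f ∘ g) = f ∘ g by rewrite cA -(cA f) gf1 cm1.
have [Z [i [p [pi1 ipe]]]] := Csplit (complement_idem fgfg).
(* The complement is proper because [f] is nonzero. *)
have ip1 : i ∘ p <> idm X.
  rewrite ipe => /(congr1 (fun h => h ∘ f)); rewrite cBl c1m -cA gf1 cm1 subrr.
  by move/esym.
apply: (@decomposes_biproduct X Y Z f i g p) => //.
- by rewrite -(cm1 i) -pi1 (cA i) ipe cA cBr cm1 cA gf1 c1m subrr c0m.
- by rewrite -(c1m p) -pi1 -(cA p) ipe -cA cBl c1m -cA gf1 cm1 subrr cm0.
- by rewrite ipe addrC subrK.
- by apply: IH; apply: leq_trans (dim_end_retract gf1 fg1) _.
- by apply: IH; apply: leq_trans (dim_end_retract pi1 ip1) _.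
Qed.

Lemma all_sum_of_simples X : sum_of_simples X.
Proof. exact: decomposes_sum (decomposes_all X). Qed.

Lemma nonzero_from_simple X Y (f : Hom X Y) : f != 0 ->
  forall n (S : 'I_n -> Obj C) (i : forall j, Hom (S j) X)
    (p : forall j, Hom X (S j)), \sum_j (i j ∘ p j) = idm X ->
  exists j, f ∘ i j != 0.
Proof.
move=> f0 n S i p e; apply/existsP; rewrite -negb_forall;
  apply: contra f0 => /forallP f0.
rewrite -(cm1 f) -e (compm_sumr Clin) big1 // => j _.
by rewrite cA (eqP (f0 j)) c0m.
Qed.

(** A simple object receives a nonzero map from the generator, hence from one of its finitely many
    simple summands, and that map is invertible. *)
Lemma simple_family_of_generator : has_generator C ->
  exists n (S : 'I_n -> Obj C),
    forall X, simple_obj X -> exists j, isomorphic (S j) X.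
Proof.
case=> G gen; have [n [S [i [p [S1 _ _ S4]]]]] := all_sum_of_simples G.
exists n, S => X sX; have [f f0] := gen X (simple_id_neq0 Clin sX).
have [j fj] := nonzero_from_simple f0 S4.
by exists j, (f ∘ i j); apply: schur_iso.
Qed.

(** The covering family may contain repetitions and non-simple objects: the indices kept are those
    of simple members not isomorphic to an earlier one. *)
Lemma complete_simples_of_family n (S : 'I_n -> Obj C) :
  (forall X, simple_obj X -> exists j, isomorphic (S j) X) ->
  exists m (T : 'I_m -> Obj C), complete_simples T.
Proof.
move=> cov; pose J := [pred j | `[< simple_obj (S j) /\
   forall l : 'I_n, (l < j)%N -> ~ isomorphic (S l) (S j) >]].
exists #|J|, (fun j => S (enum_val j)); split.
- by move=> j; have /asboolP[] := enum_valP j.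
- move=> j l jl; apply: enum_val_inj; apply: val_inj.
  have /asboolP[_ Jj] := enum_valP j; have /asboolP[_ Jl] := enum_valP l.
  case: (ltngtP (enum_val j) (enum_val l)) => // [/Jl|/Jj] []//.
  exact: isomorphic_sym.
- move=> X sX; have ex : exists m : nat, `[< exists j : 'I_n, m
    = val j /\ isomorphic (S j) X >].
    by have [j jX] := cov X sX; exists (val j); apply/asboolP; exists j.
  case: (ex_minnP ex) => m /asboolP[j [-> jX]] minj.
  have Jj : j \in J.
    apply/asboolP; split; last first.
      move=> l lj lSj; suff: (j <= l)%N by rewrite leqNgt lj.
      apply: minj; apply/asboolP; exists l; split=> //.
      exact: isomorphic_trans lSj jX.
    have [f [g [gf fg]]] := jX; case: sX => nz sX; split.
      move=> /(zero_objP Clin) z; apply: nz; apply/(zero_objP Clin).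
      by rewrite -fg -(cm1 f) z cm0 c0m.
    move=> Y h mh; have mfh : is_mono (f ∘ h).
      move=> Z a b; rewrite -!cA => e; apply: mh.
      by rewrite -(c1m (h ∘ a)) -(c1m (h ∘ b)) -gf -!cA e.
    have E : h = g ∘ (f ∘ h) by rewrite cA gf c1m.
    have [h0|[q [q1 q2]]] := sX _ _ mfh; first by left; rewrite E h0 cm0.
    right; exists (q ∘ f); split; first by rewrite -cA.
    by rewrite {1}E -!cA [f ∘ _]cA [f ∘ _ ∘ _]cA q2 c1m gf.
  exists (enum_rank_in Jj j); rewrite enum_rankK_in //.
  exact: isomorphic_sym.
Qed.
End SplitRegular.

(** * Endomorphisms of simple objects over an algebraically closed field *)

Section Endomorphisms.
Local Open Scope cat_scope.
Variables (k : closedFieldType) (C : bpdata k).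
Hypothesis Css : split_regular C.
Let Clin : linear_category C. Proof. by case: Css. Qed.

Lemma closed_eigenvector (V : vectType k) (f : 'End(V)) :
  (0 < \dim {:V})%N -> exists a v, v != 0 /\ f v = a *: v.
Proof.
move=> dV; pose e := vbasis {:V}; have eb : basis_of {:V} e := vbasisP _.
pose M := mxof e e f.
have /closed_rootP[a] : size (char_poly M) != 1.
  by rewrite size_char_poly eqSS -lt0n.
rewrite -eigenvalue_root_char => /eigenvalueP[u uM u0].
exists a, (vecof e u); rewrite vecof_eq0 ?(basis_free eb) //; split=> //.
by rewrite (hom_vecof e (e' := e)) ?uM ?linearZ //.
Qed.

(** Left composition with [f] has an eigenvector in End X; being nonzero it is invertible, and
    cancelling it shows that [f] is the eigenvalue. *)
Lemma schur_scalar (X : Obj C) (f : Hom X X) :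
  simple_obj X -> exists a, f = a *: idm X.
Proof.
move=> sX; have X0 := simple_id_neq0 Clin sX.
have dX : (0 < \dim {: @Hom k C X X})%N.
  rewrite lt0n dimv_eq0; apply: contra X0 => /eqP f0.
  by rewrite -memv0 -f0 memvf.
have [a [h [h0]]] := closed_eigenvector (linfun (fun g : Hom X X => f ∘ g)) dX.
rewrite linfunE; last exact: compm_linear.
have [q [_ hq]] := schur_iso Css sX sX h0.
move=> /(congr1 (fun g => g ∘ q)); rewrite -(compmA Clin) hq (compm1 Clin).
by rewrite (compmZl Clin) hq; exists a.
Qed.
End Endomorphisms.

(** * Full subcategories closed under sums and retracts *)

Section RetractClosed.
Local Open Scope cat_scope.
Variables (k : fieldType) (C : bpdata k) (P : Obj C -> Prop).
Hypotheses (P1 : P 𝟙) (Pt : forall X Y, P X -> P Y -> P (X ⊗ Y)).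
Hypothesis (Pd : forall X, P X -> P X^*).
Hypothesis Pretract : forall X Y, retract_of Y X -> P X -> P Y.
Hypothesis Pbiproduct : forall X Y, P X -> P Y ->
  exists S (i1 : Hom X S) (i2 : Hom Y S) (p1 : Hom S X) (p2 : Hom S Y),
    P S /\ [/\ p1 ∘ i1 = idm X, p2 ∘ i2 = idm Y, p1 ∘ i2 = 0, p2 ∘ i1 = 0
      & i1 ∘ p1 + i2 ∘ p2 = idm S].
Let D := full_sub P1 Pt Pd.

Lemma full_sub_linear : linear_category C -> linear_category D.
Proof.
by case=> H1 H2 H3 H4 H5; split=> *;
  [exact: H1|exact: H2|exact: H3|exact: H4|exact: H5].
Qed.

Lemma full_sub_split_regular : split_regular C -> split_regular D.
Proof.
case=> Clin _ Creg Csplit; split.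
- exact: full_sub_linear.
- move=> [X PX] [Y PY]; have [S [i1 [i2 [p1 [p2 [PS H]]]]]] := Pbiproduct PX PY.
  by exists (exist _ S PS), i1, i2, p1, p2.
- by move=> [X PX] [Y PY] f; exact: (Creg X Y f).
- move=> X e ee; have [Y [i [p [pi1 ipe]]]] := Csplit (sval X) e ee.
  have PY : P Y by apply: Pretract (svalP X); exists i, p.
  by exists (exist _ Y PY), i, p.
Qed.

(** Monos of the ambient category split, so a subobject of [X] is a retract of it and already lies
    in the subcategory. *)
Lemma full_sub_simple (X : Obj D) :
  split_regular C -> simple_obj X -> simple_obj (sval X).
Proof.
move=> Css sX; have Clin : linear_category C by case: Css.
have Dlin := full_sub_linear Clin.
have X0 := simple_id_neq0 Dlin sX.
split=> [/(zero_objP Clin) e|Y f mf]; first by rewrite /= e eqxx in X0.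
have [g gf1] := mono_retraction Css mf.
have PY : P Y by apply: Pretract (svalP X); exists f, g.
case: sX => _ /(_ (exist _ Y PY) f) [] //.
- by move=> Z a b; exact: mf.
- by left.
- by right.
Qed.

Lemma full_sub_simple_family : split_regular C ->
  (exists n (S : 'I_n -> Obj C), complete_simples S) ->
  exists n (S : 'I_n -> Obj D),
    forall X, simple_obj X -> exists j, isomorphic (S j) X.
Proof.
move=> Css [n [S [_ _ S3]]].
(* Simples outside the subcategory are replaced by the unit, a harmless placeholder since the family
   only has to cover. *)
exists n, (fun j => if pselect (P (S j)) is left PS
  then exist P _ PS else exist P 𝟙 P1).
move=> X sX; have [j [f [g [gf fg]]]] := S3 _ (full_sub_simple Css sX).
exists j; case: pselect => [PS|[]]; last by apply: Pretract (svalP X);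
  exists g, f.
by exists g, f.
Qed.

Lemma full_sub_finite_semisimple :
  split_regular C -> finite_semisimple C -> finite_semisimple D.
Proof.
move=> Css [_ fin]; have Dss := full_sub_split_regular Css.
split; first exact: all_sum_of_simples.
have [n [S cov]] := full_sub_simple_family Css fin.
exact: complete_simples_of_family cov.
Qed.

Lemma full_sub_monoidal : monoidal_category C -> monoidal_category D.
Proof.
case=> [[T1 T2 T3 T4] [A1 A2 A3 A4] [U1 U2 U3 U4 U5]].
split; split.
- by move=> X Y; exact: T1.
- by move=> *; exact: T2.
- by move=> *; exact: T3.
- by move=> *; exact: T4.
- by move=> *; exact: A1.
- by move=> *; exact: A2.
- by move=> *; exact: A3.
- by move=> *; exact: A4.
- by move=> X; exact: U1 (sval X).
- by move=> X; exact: U2 (sval X).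
- by move=> *; exact: U3.
- by move=> *; exact: U4.
- by move=> X Y; exact: U5 (sval X) (sval Y).
Qed.

Lemma full_sub_braided : braided_category C -> braided_category D.
Proof.
case=> B1 B2 B3 B4; split.
- by move=> X Y; exact: B1 (sval X) (sval Y).
- by move=> *; exact: B2.
- by move=> X Y Z; exact: B3 (sval X) (sval Y) (sval Z).
- by move=> X Y Z; exact: B4 (sval X) (sval Y) (sval Z).
Qed.

Lemma full_sub_rigid : rigid_category C -> rigid_category D.
Proof.
case=> R1 R2; split=> X; first exact: R1 (sval X).
exact: R2 (sval X).
Qed.

Lemma full_sub_pivotal : pivotal_category C -> pivotal_category D.
Proof.
case=> V1 V2 V3; split.
- by move=> X; exact: V1 (sval X).
- by move=> X Y f; exact: (V2 (sval X) (sval Y) f).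
- by move=> X Y; exact: V3 (sval X) (sval Y).
Qed.

Lemma full_sub_spherical : spherical_category C -> spherical_category D.
Proof. by move=> H X f; exact: (H (sval X) f). Qed.

Lemma full_sub_braided_spherical_fusion : split_regular C ->
  braided_spherical_fusion C -> braided_spherical_fusion D.
Proof.
move=> Css [[_ fin mon rig dim1] brd piv sph].
have Dss := full_sub_split_regular Css.
split; [split=> //|exact: full_sub_braided|exact: full_sub_pivotal
  |exact: full_sub_spherical].
- by split; [case: Dss | exact: split_regular_abelian].
- exact: full_sub_finite_semisimple.
- exact: full_sub_monoidal.
- exact: full_sub_rigid.
Qed.

End RetractClosed.

(** * Coherence laws for modules over D(H) *)

Section Tensors.
Variable k : fieldType.
Implicit Types U V W : vectType k.

Lemma pure_linearl U V (v : V) : linear (fun u : U => pure u v : tens U V).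
Proof. by case: (@pure_bilin k U V). Qed.

Lemma pure_linearr U V (u : U) : linear (fun v : V => pure u v : tens U V).
Proof. by case: (@pure_bilin k U V). Qed.

Lemma pureDl U V (u u' : U) (v : V) :
  pure (u + u') v = pure u v + pure u' v :> tens U V.
Proof. by have := pure_linearl v 1 u u'; rewrite !scale1r. Qed.

Lemma pureDr U V (u : U) (v v' : V) :
  pure u (v + v') = pure u v + pure u v' :> tens U V.
Proof. by have := pure_linearr u 1 v v'; rewrite !scale1r. Qed.

Definition tr V (f : 'End(V)) : k := 
  \sum_(i < \dim {:V}) coord (vbasis fullv) i (f (vbasis fullv)`_i).

(** Makes the trace independent of [vbasis]: any resolution of the identity into rank-one maps
    computes it. *)
Lemma tr_dual_basis V (f : 'End(V)) (I : finType) (x : I -> V)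
    (phi : I -> 'Hom(V, k^o)) :
  (forall v, \sum_i (phi i v : k) *: x i = v) -> tr f = \sum_i phi i (f (x i)).
Proof.
move=> dual; rewrite /tr.
under [RHS]eq_bigr => i _.
  rewrite (coord_vbasis (memvf (f (x i)))) linear_sum /=.
  under eq_bigr do rewrite linearZ /=. over.
rewrite exchange_big /=; apply: eq_bigr => j _.
rewrite -[in LHS](dual (vbasis fullv)`_j) !linear_sum /=.
by apply: eq_bigr => i _; rewrite !linearZ /= mulrC.
Qed.

End Tensors.

Section DoubleModLaws.
Local Open Scope cat_scope.
Variables (k : fieldType) (H : finGroupType).
Local Notation C := (double_mod k H).
Local Notation e_ := (@dbl k H).
Implicit Types X Y Z W : Obj C.

(** Underlying map of a morphism, locked against simplification so that categorical composites are
    evaluated only by the [app_] rewriting rules. *)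
Definition app X Y (f : Hom X Y) : dcar X -> dcar Y := vsval f.
Arguments app : simpl never.

Lemma app_inj X Y (f g : Hom X Y) : app f =1 app g -> f = g.
Proof. by move=> fg; apply: val_inj; apply/lfunP. Qed.

Lemma app_dact X Y (f : Hom X Y) x v : app f (dact X x v) = dact Y x (app f v).
Proof. exact: (dhomP _ (subvsP f)). Qed.

Lemma appD X Y (f : Hom X Y) u v : app f (u + v) = app f u + app f v.
Proof. exact: linearD. Qed.

Lemma appZ X Y (f : Hom X Y) a v : app f (a *: v) = a *: app f v.
Proof. exact: linearZ. Qed.

Lemma app_sum X Y (f : Hom X Y) (I : finType) (P : pred I) (F : I -> dcar X) :
  app f (\sum_(i | P i) F i) = \sum_(i | P i) app f (F i).
Proof. exact: linear_sum. Qed.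

Lemma app_comb X Y a (f g : Hom X Y) v :
  app (a *: f + g) v = a *: app f v + app g v.
Proof. by rewrite /app linearP /= add_lfunE scale_lfunE. Qed.

Lemma app0 X Y v : app (0 : Hom X Y) v = 0.
Proof. by rewrite /app /= zero_lfunE. Qed.

Lemma app_scale X Y a (f : Hom X Y) v : app (a *: f) v = a *: app f v.
Proof. by rewrite -[a *: f]addr0 app_comb app0 addr0. Qed.

Lemma app_sumf X Y (I : finType) (F : I -> Hom X Y) v :
  app (\sum_i F i) v = \sum_i app (F i) v.
Proof. by rewrite /app linear_sum sum_lfunE. Qed.

Lemma app_dmorph (X Y : dmod k H) (f : 'Hom(X, Y)) (fH : f \in dhom X Y) v :
  @app X Y (dmorph fH) v = f v.
Proof. by []. Qed.

Lemma app_id X v : app (idm X) v = v.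
Proof. exact: id_lfunE. Qed.

Lemma app_comp X Y Z (g : Hom Y Z) (f : Hom X Y) v :
  app (g ∘ f) v = app g (app f v).
Proof. exact: comp_lfunE. Qed.

Lemma app_tmor X X' Y Y' (f : Hom X X') (g : Hom Y Y')
    (u : dcar X) (v : dcar Y) :
  app (f ⊠ g) (pure u v) = pure (app f u) (app g v).
Proof. exact: tmapE. Qed.

Lemma app_asc X Y Z (u : dcar X) (v : dcar Y) (w : dcar Z) :
  app (asc X Y Z) (pure (pure u v : tens _ _) w) = pure u (pure v w : tens _ _).
Proof. exact: dasc_mapE. Qed.

Lemma app_ascI X Y Z (u : dcar X) (v : dcar Y) (w : dcar Z) :
  app (ascI X Y Z) (pure u (pure v w : tens _ _)) =
  pure (pure u v : tens _ _) w.
Proof. exact: dascI_mapE. Qed.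

Lemma app_lun X (a : k^o) (v : dcar X) : app (lun X) (pure a v) = (a : k) *: v.
Proof. exact: dlun_mapE. Qed.

Lemma app_lunI X v : app (lunI X) v = pure (1 : k^o) v.
Proof. exact: dlunI_mapE. Qed.

Lemma app_run X (a : k^o) (v : dcar X) : app (run X) (pure v a) = (a : k) *: v.
Proof. exact: drun_mapE. Qed.

Lemma app_runI X v : app (runI X) v = pure v (1 : k^o).
Proof. exact: drunI_mapE. Qed.

Lemma app_brd X Y (u : dcar X) (v : dcar Y) :
  app (brd X Y) (pure u v) =
  \sum_g pure (dact Y (gdbl k g) v) (dact X (e_ g 1%g) u).
Proof. exact: dbrd_mapE. Qed.

Lemma app_ev X (phi : 'Hom(dcar X, k^o)) v : app (ev X) (pure phi v) = phi v.
Proof. exact: dev_mapE. Qed.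

Lemma app_coev X (a : k^o) :
  app (coev X) a = (a : k) *: \sum_(i < \dim {:dcar X})
    (pure ((vbasis fullv)`_i : dcar X) (dcoord i) : tens _ _).
Proof. exact: dcoev_mapE. Qed.

Lemma app_piv X v (phi : 'Hom(dcar X, k^o)) :
  (app (piv X) v : 'Hom(_, _)) phi = phi v.
Proof. exact: dpiv_mapE. Qed.

Lemma tensor_ext X Y Z (f g : Hom (X ⊗ Y) Z) :
  (forall (u : dcar X) (v : dcar Y), app f (pure u v) = app g (pure u v)) ->
  f = g.
Proof. by move=> fg; apply: val_inj; apply: tens_ext. Qed.

Lemma tensor3_ext X Y Z W (f g : Hom ((X ⊗ Y) ⊗ Z) W) :
  (forall (u : dcar X) (v : dcar Y) (w : dcar Z),
     app f (pure (pure u v : tens _ _) w) =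
     app g (pure (pure u v : tens _ _) w)) ->
  f = g.
Proof.
move=> fg; apply: tensor_ext => t w; elim/tens_ind: t => // s t Es Et.
by rewrite pureDl !appD Es Et.
Qed.

Lemma tensor3r_ext X Y Z W (f g : Hom (X ⊗ (Y ⊗ Z)) W) :
  (forall (u : dcar X) (v : dcar Y) (w : dcar Z),
     app f (pure u (pure v w : tens _ _)) =
     app g (pure u (pure v w : tens _ _))) ->
  f = g.
Proof.
move=> fg; apply: tensor_ext => u t; elim/tens_ind: t => // s t Es Et.
by rewrite pureDr !appD Es Et.
Qed.

Lemma tensor4_ext X Y Z V W (f g : Hom (((X ⊗ Y) ⊗ Z) ⊗ V) W) :
  (forall (u : dcar X) (v : dcar Y) (w : dcar Z) (z : dcar V),
     app f (pure (pure (pure u v : tens _ _) w : tens _ _) z) =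
     app g (pure (pure (pure u v : tens _ _) w : tens _ _) z)) ->
  f = g.
Proof.
move=> fg; apply: tensor3_ext => t w z; elim/tens_ind: t => // s t Es Et.
by rewrite !pureDl !appD Es Et.
Qed.

Lemma is_iso_of_inverse X Y (f : Hom X Y) (g : 'Hom(dcar Y, dcar X)) :
  cancel (app f) g -> cancel g (app f) -> is_iso f.
Proof.
move=> fK gK; have gH := dhom_inv (subvsP f) fK gK.
by exists (dmorph gH); split; apply: app_inj => v; rewrite app_comp app_id
  app_dmorph.
Qed.

Lemma gdblM X (g h : H) (v : dcar X) :
  dact X (gdbl k g) (dact X (gdbl k h) v) = dact X (gdbl k (g * h)%g) v.
Proof.
rewrite [RHS]gdblE (reindex_inj (conjg_inj g^-1%g)) (gdblE h) linear_sum /=.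
by apply: eq_bigr => x _; rewrite gdbl_dbl conjgE invgK mulgA.
Qed.

Lemma gdbl1 X (v : dcar X) : dact X (gdbl k 1%g) v = v.
Proof. by rewrite gdblE dact1E. Qed.

Lemma gdbl_tens X Y (g : H) (v : dcar X) (w : dcar Y) :
  dact (X ⊗ Y) (gdbl k g) (pure v w) =
  pure (dact X (gdbl k g) v) (dact Y (gdbl k g) w).
Proof.
rewrite !gdblE pure_suml; under [RHS]eq_bigr do rewrite pure_sumr.
rewrite pair_big /= [RHS](partition_big (fun p => (p.1 * p.2)%g) xpredT) //=.
by apply: eq_bigr => x _; rewrite dtens_actE.
Qed.

Lemma double_linear : linear_category C.
Proof.
split.
- by move=> *; apply: app_inj => v; rewrite !app_comp.
- by move=> *; apply: app_inj => v; rewrite app_comp app_id.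
- by move=> *; apply: app_inj => v; rewrite app_comp app_id.
- by move=> *; apply: app_inj => v; rewrite !(app_comp, app_comb) appD appZ.
- by move=> *; apply: app_inj => v; rewrite !(app_comp, app_comb).
Qed.

Lemma double_monoidal : monoidal_category C.
Proof.
split; split.
- by move=> X Y; apply: tensor_ext => u v; rewrite app_tmor !app_id.
- by move=> *; apply: tensor_ext => u v; rewrite app_comp !app_tmor !app_comp.
- by move=> *; apply: tensor_ext => u v;
    rewrite app_comb !app_tmor app_comb pure_linearl.
- by move=> *; apply: tensor_ext => u v;
    rewrite app_comb !app_tmor app_comb pure_linearr.
- by move=> X Y Z; apply: tensor3_ext => u v w;
    rewrite app_comp app_asc app_ascI app_id.
- by move=> X Y Z; apply: tensor3r_ext => u v w;
    rewrite app_comp app_ascI app_asc app_id.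
- by move=> *; apply: tensor3_ext => u v w;
    rewrite !(app_comp, app_asc, app_tmor).
- by move=> *; apply: tensor4_ext => u v w z;
    rewrite !(app_comp, app_asc, app_tmor, app_id).
- move=> X; split; last by apply: app_inj => v;
    rewrite app_comp app_lunI app_lun scale1r app_id.
  apply: tensor_ext => a v;
    rewrite app_comp app_lun app_lunI app_id pure_scaler -pure_scalel.
  by rewrite /GRing.scale /= mulr1.
- move=> X; split; last by apply: app_inj => v;
    rewrite app_comp app_runI app_run scale1r app_id.
  apply: tensor_ext => a v;
    rewrite app_comp app_run app_runI app_id pure_scalel -pure_scaler.
  by rewrite /GRing.scale /= mulr1.
- by move=> *; apply: tensor_ext => a v;
    rewrite !(app_comp, app_tmor, app_lun, app_id) appZ.
- by move=> *; apply: tensor_ext => a v;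
    rewrite !(app_comp, app_tmor, app_run, app_id) appZ.
- move=> *; apply: tensor3_ext => u a v.
  by rewrite !(app_comp, app_tmor, app_asc, app_run, app_lun, app_id)
    pure_scaler pure_scalel.
Qed.

Lemma double_braided : braided_category C.
Proof.
split.
(* The inverse braiding uses [g^-1] in place of [g]; the two cancel because the [e_g] are orthogonal
   idempotents with sum 1. *)
- move=> X Y; pose f : 'Hom(tens (dcar Y) (dcar X), tens (dcar X) (dcar Y)) :=
    tlift (fun v u => \sum_g pure (dact X (e_ g 1%g) u) (dact Y
      (gdbl k g^-1%g) v)).
  have fE v u : f (pure v u) =
      \sum_g pure (dact X (e_ g 1%g) u) (dact Y (gdbl k g^-1%g) v).
    rewrite tliftE //; split=> w a s t; rewrite scaler_sumr -big_split;
      apply: eq_bigr => g _; rewrite linearP.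
      by rewrite pure_linearr.
    by rewrite pure_linearl.
  apply: (@is_iso_of_inverse (X ⊗ Y) (Y ⊗ X) (brd X Y) f).
    elim/tens_ind=> [u v|s t Es Et]; last by rewrite appD linearD /= Es Et.
    rewrite app_brd linear_sum.
    transitivity (\sum_g pure (dact X (e_ g 1%g) u) v); last first.
      by rewrite -pure_suml dact1E.
    apply: eq_bigr => g _; rewrite /= fE
      (bigD1 g) //= dactME !(mul1g, mulg1, invg1) eqxx.
    rewrite gdblM mulVg gdbl1 big1 ?addr0 // => h hg.
    by rewrite dactME !(mul1g, mulg1, invg1) (negPf hg) pure0l.
  elim/tens_ind=> [v u|s t Es Et]; last by rewrite linearD /= appD Es Et.
  rewrite fE app_sum.
  transitivity (\sum_g pure v (dact X (e_ g 1%g) u)); last first.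
    by rewrite -pure_sumr dact1E.
  apply: eq_bigr => g _; rewrite app_brd
    (bigD1 g) //= dactME !(mul1g, mulg1, invg1) eqxx.
  rewrite gdblM mulgV gdbl1 big1 ?addr0 // => h hg.
  by rewrite dactME !(mul1g, mulg1, invg1) (negPf hg) pure0r.
- move=> X X' Y Y' f g; apply: tensor_ext => u v.
  rewrite !app_comp app_tmor !app_brd app_sum; apply: eq_bigr => x _.
  by rewrite app_tmor !app_dact.
(* First hexagon: group elements are grouplike ([gdbl_tens]), and orthogonality of the [e_g]
   collapses the double sum. *)
- move=> X Y Z; apply: tensor3_ext => u v w.
  rewrite !app_comp app_asc app_brd app_tmor app_brd app_id pure_suml !app_sum.
  apply: eq_bigr => g _; rewrite app_asc app_tmor app_brd app_id pure_sumr.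
  rewrite gdbl_tens app_asc (bigD1 g) //= dactME !(mul1g, mulg1, invg1) eqxx.
  by rewrite big1 ?addr0 // => h hg;
    rewrite dactME !(mul1g, mulg1, invg1) (negPf hg) !pure0r.
(* Second hexagon: the coproduct splits [e_g] over the factorizations of [g], and the group elements
   of the two factors compose to [g]. *)
- move=> X Y Z; apply: tensor3r_ext => u v w.
  rewrite !app_comp app_ascI app_brd app_tmor app_brd app_id pure_sumr !app_sum.
  under eq_bigr => g _.
    rewrite dtens_actE pure_sumr app_sum.
    under eq_bigr do rewrite app_ascI. over.
  under [RHS]eq_bigr => g _.
    rewrite app_ascI app_tmor app_brd app_id pure_suml. over.
  rewrite [RHS]exchange_big pair_big [RHS](partition_big (fun p =>
    (p.1 * p.2)%g) xpredT) //=.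
  by apply: eq_bigr => g _; apply: eq_bigr => p /eqP <-; rewrite gdblM.
Qed.

Lemma dcoord_sum X (v : dcar X) :
  \sum_(i < \dim {:dcar X})
    (dcoord i v : k) *: ((vbasis fullv)`_i : dcar X) = v.
Proof.
by rewrite [RHS](coord_vbasis (memvf v)); apply: eq_bigr => i _;
  rewrite dcoordE.
Qed.

(** The mate is currying; this is what reduces the statements on duals to evaluations of
    functionals. *)
Lemma app_mate B X (p : Hom (B ⊗ X) 𝟙) (b : dcar B) (x : dcar X) :
  (app (mate p) b : 'Hom(dcar X, k^o)) x = app p (pure b x).
Proof.
rewrite !app_comp app_runI app_tmor app_id app_coev scale1r pure_sumr !app_sum.
rewrite sum_lfunE -[x in RHS]dcoord_sum pure_sumr app_sum.
apply: eq_bigr => i _; rewrite app_ascI app_tmor app_id app_lun scale_lfunE.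
by rewrite pure_scaler appZ /GRing.scale /= mulrC.
Qed.

Lemma app_evr X (x : dcar X) (phi : 'Hom(dcar X, k^o)) :
  app (evr X) (pure x phi) = phi x.
Proof. by rewrite app_comp app_tmor app_id app_ev app_piv. Qed.

Lemma app_dualm X Y (f : Hom X Y) (phi : 'Hom(dcar Y, k^o)) x :
  (app (dualm f) phi : 'Hom(dcar X, k^o)) x = phi (app f x).
Proof. by rewrite app_mate app_comp app_tmor app_id app_ev. Qed.

Lemma app_dual_tensor X Y (psi : 'Hom(dcar Y, k^o)) (phi : 'Hom(dcar X, k^o))
    (x : dcar X) (y : dcar Y) :
  (app (dual_tensor X Y) (pure psi phi) : 'Hom(dcar (X ⊗ Y), k^o))
    (pure x y) = (phi x : k) * (psi y : k).
Proof.
rewrite app_mate !app_comp app_asc app_tmor app_id !app_comp app_ascI.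
by rewrite app_tmor app_ev app_id app_lun app_ev linearZ.
Qed.

Lemma double_rigid : rigid_category C.
Proof.
split=> X; apply: app_inj => v.
  rewrite !app_comp app_lunI app_tmor app_id app_coev scale1r pure_suml
    !app_sum.
  rewrite -[RHS]dcoord_sum; apply: eq_bigr => i _.
  by rewrite app_asc app_tmor app_ev app_id app_run.
(* The second zigzag composite is by definition the mate of [ev X]. *)
by apply/lfunP => x; apply: etrans (app_mate (ev X) _ _) _;
  rewrite app_ev app_id.
Qed.

Lemma double_pivotal : pivotal_category C.
Proof.
split.
- move=> X; split; apply: app_inj => v; rewrite app_comp app_id.
    exact: dpivK.
  exact: dpivIK.
- move=> X Y f; apply: app_inj => v; apply/lfunP => phi.
  rewrite [in LHS]app_comp [in RHS]app_comp.
  apply: etrans _ (esym (app_dualm (dualm f) (app (piv X) v) phi)).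
  by rewrite !app_piv app_dualm.
- move=> X Y; apply: tensor_ext => x y; apply: tens_ext => psi phi.
  rewrite [in LHS]app_comp [in RHS]app_comp app_tmor.
  have E := app_dualm (dual_tensor X Y) (app (piv (X ⊗ Y)) (pure x y))
    (pure psi phi).
  apply: etrans E _.
  apply: etrans _ (esym (app_dual_tensor (app (piv X) x) (app
    (piv Y) y) psi phi)).
  by rewrite !app_piv app_dual_tensor mulrC.
Qed.

Lemma app_rtrace X (f : Hom X X) (a : k^o) :
  app (rtrace f) a = a * tr (vsval f).
Proof.
rewrite /rtrace app_comp (app_comp (evr X)) app_coev !appZ; congr (_ * _).
rewrite !app_sum.
by apply: eq_bigr => i _; rewrite app_tmor app_id app_evr dcoordE.
Qed.

Lemma double_spherical : spherical_category C.
Proof.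
move=> X f; apply: app_inj => a; rewrite app_rtrace.
rewrite !app_comp app_coev !appZ; congr (_ * _); rewrite !app_sum.
(* The left trace runs over a basis of the dual space; pulling its dual basis back along [pivI]
   gives another pair of dual families for [X]. *)
rewrite (tr_dual_basis _ (phi := fun i => (vbasis fullv)`_i)
  (x := fun j => app (pivI X) (dcoord j))).
  by apply: eq_bigr => i _; rewrite !app_tmor !app_id app_ev.
move=> v; have {2}<- : app (pivI X) (app (piv X) v) = v by exact: dpivK.
have -> : app (piv X) v = \sum_(i < \dim {:dcar (dual X)})
    ((vbasis {:dcar (dual X)})`_i v : k) *: (dcoord i : dcar (dual (dual X))).
  apply/lfunP => phi; rewrite app_piv sum_lfunE -[phi in LHS]dcoord_sum
    sum_lfunE.
  by apply: eq_bigr => i _; rewrite !scale_lfunE /GRing.scale /= mulrC.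
by rewrite app_sum; apply: eq_bigr => i _; rewrite appZ.
Qed.

(** The twist is a partial trace of the braiding: contracting the dual bases leaves the sum of the
    [g e_g], and [g e_g = e_g g]. *)
Lemma app_twist X (v : dcar X) : app (twist X) v = \sum_g dact X (e_ g g) v.
Proof.
rewrite !app_comp app_runI app_tmor app_id app_coev scale1r pure_sumr !app_sum.
transitivity (\sum_(i < \dim {:dcar X}) \sum_g
    (dcoord i (dact X (e_ g 1%g) v) : k) *: dact X (gdbl k g)
      (vbasis fullv)`_i).
  apply: eq_bigr => i _; rewrite app_ascI app_tmor app_brd app_id pure_suml
    !app_sum.
  by apply: eq_bigr => g _; rewrite app_asc app_tmor app_evr app_id app_run.
rewrite exchange_big; apply: eq_bigr => g _.
transitivity (dact X (gdbl k g) (dact X (e_ g 1%g) v)).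
  move: (dact X (gdbl k g)) (dact X (e_ g 1%g) v) => f w.
  rewrite -[w in RHS]dcoord_sum linear_sum /=.
  by apply: eq_bigr => i _; rewrite linearZ.
by rewrite gdbl_dbl mulgK mulg1.
Qed.

Lemma double_dim_end_unit : \dim {: @Hom k C 𝟙 𝟙} = 1%N.
Proof.
apply/eqP; rewrite eqn_leq; apply/andP; split.
  rewrite dimvf /=; apply: leq_trans (dimvS (subvf (dhom (dunit k H)
    (dunit k H)))) _.
  by rewrite dimvf /dim /= mul1n.
rewrite lt0n dimv_eq0; apply/eqP => e0.
have : idm 𝟙 \in (fullv : {vspace @Hom k C 𝟙 𝟙}) by rewrite memvf.
rewrite e0 memv0 => /eqP /(congr1 (fun f : @Hom k C 𝟙 𝟙 => app f (1 : k^o))).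
rewrite app_id => /eqP; rewrite /app /= zero_lfunE oner_eq0.
by [].
Qed.

End DoubleModLaws.

(** * Semisimplicity of modules over D(H) *)

Section Averaging.
Variables (k : fieldType) (H : finGroupType).
Local Notation e_ := (@dbl k H).
Implicit Types X Y : dmod k H.

(* The sum over g, h of h e_g A e_g h^-1, reindexed with h e_{g^h} = e_g h.   *)
Definition avg X Y (A : 'Hom(X, Y)) : 'Hom(X, Y) :=
  \sum_(p : H * H)
    (dact Y (e_ p.1 p.2) \o A \o dact X (e_ (p.1 ^ p.2)%g p.2^-1%g))%VF.

Lemma avgE X Y (A : 'Hom(X, Y)) v :
  avg A v = \sum_g \sum_h
    dact Y (e_ g h) (A (dact X (e_ (g ^ h)%g h^-1%g) v)).
Proof.
rewrite /avg sum_lfunE pair_big /=.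
by apply: eq_bigr => p _; rewrite !comp_lfunE.
Qed.

(** Multiplying by [e_a b] leaves one value of [g] on either side, namely [a] and [a ^ b]; the two
    remaining sums over [h] differ by the translation by [b]. *)
Lemma avg_dhom X Y (A : 'Hom(X, Y)) : avg A \in dhom X Y.
Proof.
apply: dhom_basisP => a b v; rewrite !avgE [RHS]linear_sum /=.
rewrite [LHS](bigD1 a) //= [X in _ + X]big1 => [|g ga]; last first.
  rewrite big1 // => h _; rewrite dactME invgK conjgE -mulgA.
  rewrite (inj_eq (mulgI _)) (inj_eq (mulIg _)) (negPf ga).
  by rewrite !linear0.
rewrite [RHS](bigD1 (a ^ b)%g) //= [X in _ = _ + X]big1 => [|g ga]; last first.
  rewrite linear_sum big1 //= => h _; rewrite dactME.
  case: eqP => // e; case/eqP: ga.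
  by rewrite e conjgE !mulgA mulVg mul1g mulgKV.
rewrite !addr0 [RHS]linear_sum /= [LHS](reindex_inj (mulgI b)) /=.
apply: eq_bigr => h _; rewrite !dactME invgK !conjgE !invMg !mulgA.
by rewrite !(mulgKV, mulgK) mulgV mul1g !eqxx.
Qed.

Lemma conj_e X g h (v : X) :
  dact X (e_ g h) (dact X (e_ (g ^ h)%g h^-1%g) v) = dact X (e_ g 1%g) v.
Proof. by rewrite dactME conjgE !mulgA mulgV mul1g mulgK eqxx. Qed.

End Averaging.

Section DoubleSemisimple.
Local Open Scope cat_scope.
Variables (k : fieldType) (H : finGroupType).
Hypothesis cardH : #|H|%:R != 0 :> k.
Local Notation C := (double_mod k H).
Local Notation e_ := (@dbl k H).

(** Maschke's argument: a linear pseudo-inverse of [f] is averaged and divided by the order of H. As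
    [f] commutes with the action, each term of the average sandwiched between two copies of [f]
    reduces to [f] composed with [e_g]. *)
Lemma double_regular : von_neumann_regular C.
Proof.
move=> X Y f.
have gH : #|H|%:R^-1 *: avg
  (vsval f)^-1%VF \in dhom Y X by rewrite memvZ // avg_dhom.
exists (dmorph gH); apply: app_inj => v.
rewrite !app_comp app_dmorph scale_lfunE appZ avgE.
have -> : app f (\sum_g \sum_h dact X (e_ g h)
    ((vsval f)^-1%VF (dact Y (e_ (g ^ h)%g h^-1%g) (app f v)))) =
  \sum_g \sum_(h : H) app f (dact X (e_ g 1%g) v).
  rewrite app_sum; apply: eq_bigr => g _; rewrite app_sum;
    apply: eq_bigr => h _.
  rewrite -(conj_e g h v) !(app_dact f (e_ g h)); congr (dact Y _ _).
  rewrite -(app_dact f (e_ (g ^ h)%g h^-1%g)).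
  have := congr1 (fun F : 'Hom(_, _) =>
    F (dact X (e_ (g ^ h)%g h^-1%g) v)) (inv_lfun_def (vsval f)).
  by rewrite !comp_lfunE.
under eq_bigr do rewrite sumr_const.
rewrite sumrMnl -app_sum dact1E -scaler_nat scalerA.
by rewrite mulVf ?scale1r.
Qed.

Section Retract.
Variables (X : dmod k H) (V : vectType k) (i : 'Hom(V, X)) (p : 'Hom(X, V)).
Hypotheses (iK : cancel i p) (ipH : (i \o p)%VF \in dhom X X).

Definition dretr_act : 'Hom(double k H, 'End(V)) :=
  linfun (fun x => (p \o dact X x \o i)%VF).

Lemma dretr_actE x v : dretr_act x v = p (dact X x (i v)).
Proof.
rewrite /dretr_act linfunE ?comp_lfunE // => a y z.
by rewrite linearP comp_lfunDr comp_lfunDl -comp_lfunZr -comp_lfunZl.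
Qed.

Lemma dretr_i x v : i (dretr_act x v) = dact X x (i v).
Proof.
rewrite dretr_actE -comp_lfunE (dhomP _ ipH) comp_lfunE.
by rewrite iK.
Qed.

Lemma dretr1 : dretr_act 1 = \1%VF.
Proof. by apply/lfunP => v; rewrite dretr_actE dact1 !id_lfunE iK. Qed.

Lemma dretrM x y : dretr_act (x * y) = (dretr_act x \o dretr_act y)%VF.
Proof.
apply/lfunP => v; rewrite comp_lfunE !dretr_actE dactM comp_lfunE.
by rewrite -[in RHS](dretr_actE y) dretr_i.
Qed.

Definition dretr : dmod k H := DMod dretr1 dretrM.

Lemma dretr_iH : i \in dhom dretr X.
Proof. by apply/dhomP => x v; rewrite dretr_i. Qed.

Lemma dretr_pH : p \in dhom X dretr.
Proof.
apply/dhomP => x v; rewrite /= dretr_actE -comp_lfunE.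
by have := dhomP _ ipH x v; rewrite !comp_lfunE => <-; rewrite iK.
Qed.

End Retract.

Lemma double_idempotents_split : idempotents_split C.
Proof.
move=> X e ee; pose U := limg (vsval e).
have eU u : u \in U -> vsval e u = u.
  by case/memv_imgP => v _ ->; have := congr1 (fun f => app f v) ee;
    rewrite app_comp.
have mU v : vsval e v \in U by rewrite memv_img ?memvf.
pose i : 'Hom(subvs_of U, dcar X) := linfun vsval.
pose p : 'Hom(dcar X, subvs_of U) := linfun (vsproj U \o vsval e).
have iE u : i u = vsval u by rewrite lfunE.
have pE v : p v = vsproj U (vsval e v) by rewrite lfunE.
have ipE v : i (p v) = app e v by rewrite iE pE vsprojK.
have iK : cancel i p.
  by move=> u; rewrite pE iE; apply: val_inj; rewrite /= vsprojK // eU ?subvsP.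
have ipH : (i \o p)%VF \in dhom X X.
  have -> : (i \o p)%VF = vsval e by apply/lfunP => v; rewrite comp_lfunE ipE.
  exact: subvsP.
exists (dretr iK ipH), (dmorph (dretr_iH iK ipH)), (dmorph (dretr_pH iK ipH)).
split; apply: app_inj => v; rewrite app_comp !app_dmorph //.
by rewrite id_lfunE iK.
Qed.

Section Sum.
Variables X Y : dmod k H.

Definition dsum_act : 'Hom(double k H, 'End((dcar X * dcar Y)%type)) :=
  linfun (fun x => linfun (fun v : dcar X * dcar Y =>
    (dact X x v.1, dact Y x v.2))).

Lemma dsum_actE x v : dsum_act x v = (dact X x v.1, dact Y x v.2).
Proof.
have l y : linear (fun v : dcar X * dcar Y => (dact X y v.1, dact Y y v.2)).
  by move=> a u w /=; rewrite !linearP.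
rewrite /dsum_act !linfunE // => a y z; apply/lfunP => u.
by rewrite add_lfunE scale_lfunE !linfunE // !linearP /= !add_lfunE
  !scale_lfunE.
Qed.

Lemma dsum_act1 : dsum_act 1 = \1%VF.
Proof. by apply/lfunP => -[u v]; rewrite dsum_actE !dact1 !id_lfunE. Qed.

Lemma dsum_actM x y : dsum_act (x * y) = (dsum_act x \o dsum_act y)%VF.
Proof.
by apply/lfunP => v; rewrite comp_lfunE !dsum_actE !dactM !comp_lfunE.
Qed.

Definition dplus : dmod k H := DMod dsum_act1 dsum_actM.

Lemma dact_plus x v : dact dplus x v = (dact X x v.1, dact Y x v.2).
Proof. exact: dsum_actE. Qed.

Lemma dplus_biproduct : exists (i1 : @Hom k C X dplus) (i2 : @Hom k C Y dplus)
    (p1 : @Hom k C dplus X) (p2 : @Hom k C dplus Y),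
  [/\ p1 ∘ i1 = @idm k C X, p2 ∘ i2 = @idm k C Y, p1 ∘ i2 = 0, p2 ∘ i1 = 0
    & i1 ∘ p1 + i2 ∘ p2 = @idm k C dplus].
Proof.
pose V := (dcar X * dcar Y)%type.
have l1 : linear (fun u : dcar X => (u, 0) : V).
  by move=> a u w /=; congr (_, _); rewrite /= scaler0 addr0.
have l2 : linear (fun u : dcar Y => (0, u) : V).
  by move=> a u w /=; congr (_, _); rewrite /= scaler0 addr0.
have l3 : linear (fun v : V => v.1) by [].
have l4 : linear (fun v : V => v.2) by [].
have h1 : linfun (fun u : dcar X => (u, 0) : V) \in dhom X dplus.
  by apply/dhomP => x v; rewrite dact_plus !(linfunE l1) linear0.
have h2 : linfun (fun u : dcar Y => (0, u) : V) \in dhom Y dplus.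
  by apply/dhomP => x v; rewrite dact_plus !(linfunE l2) linear0.
have h3 : linfun (fun v : V => v.1) \in dhom dplus X.
  by apply/dhomP => x v; rewrite dact_plus !(linfunE l3).
have h4 : linfun (fun v : V => v.2) \in dhom dplus Y.
  by apply/dhomP => x v; rewrite dact_plus !(linfunE l4).
exists (dmorph h1), (dmorph h2), (dmorph h3), (dmorph h4).
have E := (linfunE l1, linfunE l2, linfunE l3, linfunE l4).
split; apply: app_inj => v; rewrite ?app_comp ?app_id.
- by rewrite !app_dmorph !E.
- by rewrite !app_dmorph !E.
- by rewrite !app_dmorph !E /app /= zero_lfunE.
- by rewrite !app_dmorph !E /app /= zero_lfunE.
rewrite -[_ ∘ _]scale1r app_comb scale1r !app_comp !app_dmorph !E.
by case: v => u w; congr (_, _); rewrite /= ?addr0 ?add0r.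
Qed.
End Sum.

Definition dreg_act : 'Hom(double k H, 'End(double k H)) :=
  linfun (fun x : double k H => linfun (fun y : double k H => x * y)).

Lemma dreg_actE (x y : double k H) : dreg_act x y = x * y.
Proof.
have l z : linear (fun y : double k H => z * y).
  by move=> a u w; rewrite mulrDr scalerAr.
rewrite /dreg_act !linfunE // => a u w; apply/lfunP => z.
by rewrite add_lfunE scale_lfunE !linfunE // mulrDl scalerAl.
Qed.

Lemma dreg_act1 : dreg_act 1 = \1%VF.
Proof. by apply/lfunP => v; rewrite dreg_actE mul1r id_lfunE. Qed.

Lemma dreg_actM x y : dreg_act (x * y) = (dreg_act x \o dreg_act y)%VF.
Proof. by apply/lfunP => v; rewrite comp_lfunE !dreg_actE mulrA. Qed.

Definition dreg : dmod k H := DMod dreg_act1 dreg_actM.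

Lemma dact_reg (x y : double k H) : dact dreg x y = x * y.
Proof. exact: dreg_actE. Qed.

(** The regular module maps to any module by acting on a chosen vector, and 1 goes to that
    vector. *)
Lemma double_generator : has_generator C.
Proof.
exists dreg => X X0.
have [[v v0]|nv] := pselect (exists v : dcar X, v != 0); last first.
  case/eqP: X0; apply: app_inj => v; rewrite app_id /app zero_lfunE.
  by apply/eqP; have [//|v0] := boolP (v == 0); case: nv; exists v.
have l : linear (fun x : double k H => dact X x v).
  by move=> a x y; rewrite linearP /= add_lfunE scale_lfunE.
have fH : linfun (fun x : double k H => dact X x v) \in dhom dreg X.
  by apply/dhomP => x y; rewrite dact_reg !(linfunE l) dactM comp_lfunE.
exists (dmorph fH); apply: contra v0 => /eqP/(congr1 (fun f : @Hom k C dreg X =>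
  app f (1 : double k H))).
by rewrite app_dmorph (linfunE l) dact1 id_lfunE => ->; rewrite /app zero_lfunE.
Qed.

Lemma double_split_regular : split_regular C.
Proof.
split.
- exact: double_linear.
- by move=> X Y; exists (dplus X Y); exact: dplus_biproduct.
- exact: double_regular.
- exact: double_idempotents_split.
Qed.

Lemma double_braided_spherical_fusion : braided_spherical_fusion C.
Proof.
have Css := double_split_regular.
split; [split|exact: double_braided|exact: double_pivotal
  |exact: double_spherical].
- by split; [exact: double_linear|exact: split_regular_abelian].
- split; first exact: all_sum_of_simples.
  have [n [S cov]] := simple_family_of_generator Css double_generator.
  exact: complete_simples_of_family cov.
- exact: double_monoidal.
- exact: double_rigid.
- exact: double_dim_end_unit.
Qed.

End DoubleSemisimple.

(** * The S-matrix *)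

Section Traces.
Variable k : fieldType.
Implicit Types V W : vectType k.

Lemma tr_linear V : linear (@tr k V : 'End(V) -> k^o).
Proof.
move=> a f g; rewrite /tr scaler_sumr -big_split /=; apply: eq_bigr => i _.
by rewrite add_lfunE scale_lfunE linearP.
Qed.

Lemma tr_sum V (I : finType) (F : I -> 'End(V)) :
  tr (\sum_i F i) = \sum_i tr (F i).
Proof.
rewrite -[LHS](linfunE (@tr_linear V)) linear_sum /=.
by apply: eq_bigr => i _; rewrite (linfunE (@tr_linear V)).
Qed.

Lemma trZ V a (f : 'End(V)) : tr (a *: f) = a * tr f.
Proof.
by rewrite -[LHS](linfunE (@tr_linear V)) linearZ /= (linfunE (@tr_linear V)).
Qed.

Lemma tr0 V : tr (0 : 'End(V)) = 0.
Proof. by rewrite -(scale0r (0 : 'End(V))) trZ mul0r. Qed.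

Lemma tr1 V : tr (\1%VF : 'End(V)) = (\dim {:V})%:R.
Proof.
rewrite /tr (eq_bigr (fun=> 1)) ?sumr_const ?card_ord // => i _.
by rewrite id_lfunE coord_free ?(basis_free (vbasisP _)) // eqxx.
Qed.

Lemma trC V (f g : 'End(V)) : tr (f \o g)%VF = tr (g \o f)%VF.
Proof.
have E (f' g' : 'End(V)) : tr (f' \o g')%VF =
  \sum_(i < \dim {:V}) \sum_(j < \dim {:V})
    coord (vbasis fullv) j (g' (vbasis fullv)`_i) *
    coord (vbasis fullv) i (f' (vbasis fullv)`_j).
  apply: eq_bigr => i _; rewrite comp_lfunE.
  move: (g' _) => w; rewrite [in LHS](coord_vbasis (memvf w)) !linear_sum /=.
  by apply: eq_bigr => j _; rewrite !linearZ.
rewrite !E exchange_big; apply: eq_bigr => i _; apply: eq_bigr => j _.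
by rewrite mulrC.
Qed.

Lemma tr_tens V W (I : finType) (F : 'End(tens V W))
    (f : I -> 'End(V)) (g : I -> 'End(W)) :
  (forall u v, F (pure u v) = \sum_i pure (f i u) (g i v)) ->
  tr F = \sum_i tr (f i) * tr (g i).
Proof.
move=> FE; pose b V' i := (vbasis {:V'})`_i.
have l i j : linear (fun t : tens V W => t i j : k^o) by move=> a s t;
  rewrite !mxE.
rewrite (tr_dual_basis _ (phi := fun p => linfun (fun t : tens V W =>
  t p.1 p.2 : k^o))
  (x := fun p : 'I_(\dim {:V}) * 'I_(\dim {:W}) => pure (b V p.1) (b W p.2))).
  under eq_bigr => p _.
    rewrite FE linear_sum /=.
    under eq_bigr => i _ do rewrite linfunE // mxE.
    over.
  rewrite exchange_big /=; apply: eq_bigr => i _.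
  by rewrite /tr big_distrlr pair_big.
move=> t; apply/matrixP=> i j;
  rewrite summxE (bigD1 (i, j)) //= big1 => [|p pij].
  rewrite linfunE // !mxE !coord_free ?(basis_free (vbasisP _)) // !eqxx.
  by rewrite !mulr1 addr0.
rewrite linfunE // !mxE !coord_free ?(basis_free (vbasisP _)) //.
case: p pij => i' j' /=; rewrite xpair_eqE negb_and (eq_sym i') (eq_sym j').
by case/orP=> /negPf->; rewrite ?mul0r ?mulr0 ?mul0r ?mulr0.
Qed.

End Traces.

(** * Characters of D(H), their orthogonality, and invertibility of the S-matrix *)

Section Characters.
Local Open Scope cat_scope.
Variables (k : numClosedFieldType) (H : finGroupType).
Local Notation C := (double_mod k H).
Local Notation e_ := (@dbl k H).
Implicit Types X Y : dmod k H.

Definition chi X (x : double k H) : k := tr (dact X x).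

Lemma cardH_neq0 : #|H|%:R != 0 :> k.
Proof. by rewrite pnatr_eq0 -lt0n; apply/card_gt0P; exists 1%g. Qed.

Let Css : split_regular C := double_split_regular cardH_neq0.

Lemma chi_gdbl_dbl X g h : chi X (e_ (h * g * h^-1)%g h) = chi X (e_ g h).
Proof.
rewrite /chi.
have -> : dact X (e_ (h * g * h^-1)%g h) = (dact X (gdbl k h) \o dact X
  (e_ g 1%g))%VF.
  by apply/lfunP => v; rewrite comp_lfunE gdbl_dbl mulg1.
by rewrite trC; congr tr; apply/lfunP => v; rewrite comp_lfunE dbl_gdbl mul1g.
Qed.

Lemma chi_conj X g h x : chi X (e_ (g ^ x)%g (h ^ x)%g) = chi X (e_ g h).
Proof.
rewrite /chi.
have -> : dact X (e_ (g ^ x)%g (h ^ x)%g) =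
    (dact X (gdbl k x^-1%g) \o dact X (e_ g (h * x)%g))%VF.
  by apply/lfunP => v; rewrite comp_lfunE gdbl_dbl invgK !conjgE mulgA.
rewrite trC; congr tr; apply/lfunP => v; rewrite comp_lfunE dbl_gdbl mulgK.
by [].
Qed.

(** The element [e_g h] maps the summand of degree [g ^ h] to that of degree [g], so it is
    off-diagonal unless [g] and [h] commute. *)
Lemma chi_support X g h : (g ^ h)%g != g -> chi X (e_ g h) = 0.
Proof.
move=> gh; rewrite /chi.
have -> : dact X (e_ g h) = (dact X (e_ g 1%g) \o dact X (e_ g h))%VF.
  by apply/lfunP => v; rewrite comp_lfunE dactME !(mul1g, mulg1, invg1) eqxx.
rewrite trC; have -> : (dact X (e_ g h) \o dact X (e_ g 1%g))%VF = 0;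
  last exact: tr0.
apply/lfunP => v; rewrite comp_lfunE dactME zero_lfunE; case: eqP => // e.
by case/eqP: gh; rewrite {1}e conjgE !mulgA mulVg mul1g mulgKV.
Qed.

Definition rank_one (V W : vectType k) (i : 'I_(\dim {:V}))
    (w : W) : 'Hom(V, W) :=
  linfun (fun v => coord (vbasis fullv) i v *: w).

Lemma rank_oneE (V W : vectType k) (i : 'I_(\dim {:V})) (w : W) v :
  rank_one i w v = coord (vbasis fullv) i v *: w.
Proof.
by rewrite /rank_one linfunE // => a u u'; rewrite linearP scalerDl scalerA.
Qed.

(* Both sides are a trace on Hom(X, Y): of the averaging operator, and of the *)
(* maps A |-> (e_g h) A (e_{g^h} h^-1) it is the sum of.                      *)
Lemma chi_product X Y :
  \sum_g \sum_h chi Y (e_ g h) * chi X (e_ (g ^ h)%g h^-1%g) =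
  \sum_(i < \dim {:dcar X}) \sum_(j < \dim {:dcar Y}) coord (vbasis fullv) j
    (avg (rank_one i ((vbasis fullv)`_j : dcar Y)) (vbasis fullv)`_i).
Proof.
under [RHS]eq_bigr => i _ do under eq_bigr => j _ do
  rewrite avgE pair_big linear_sum /=.
rewrite pair_big [RHS]pair_big exchange_big /=; apply: eq_bigr => -[g h] _ /=.
rewrite -(pair_big xpredT xpredT (fun i j => coord (vbasis fullv) j
  (dact Y (e_ g h) (rank_one i (vbasis fullv)`_j
     (dact X (e_ (g ^ h)%g h^-1%g) (vbasis fullv)`_i))))) /= exchange_big.
rewrite /chi /tr big_distrlr /=; apply: eq_bigr => j _; apply: eq_bigr => i _.
by rewrite rank_oneE !linearZ mulrC.
Qed.

(** By [chi_product] this is the trace of averaging, whose values are module maps from [X] to [Y];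
    these vanish by Schur's lemma. *)
Lemma chi_orth_neq X Y : simple_obj (X : Obj C) -> simple_obj (Y : Obj C) ->
  ~ @isomorphic k C X Y ->
  \sum_g \sum_h chi Y (e_ g h) * chi X (e_ (g ^ h)%g h^-1%g) = 0.
Proof.
move=> sX sY nXY; rewrite chi_product big1 // => i _; rewrite big1 // => j _.
set A := rank_one _ _; have [f0|fn0] := eqVneq (dmorph (avg_dhom A)) 0.
  by rewrite -[avg A]/(vsval (dmorph (avg_dhom A))) f0 /= zero_lfunE linear0.
case: nXY; exists (dmorph (avg_dhom A)).
exact: (@schur_iso k C Css X Y).
Qed.

Lemma simple_dim_gt0 X : simple_obj (X : Obj C) -> (0 < \dim {:dcar X})%N.
Proof.
move=> sX; rewrite lt0n dimv_eq0; apply/negP => /eqP X0.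
have /eqP[] := simple_id_neq0 (double_linear k H) sX.
apply: app_inj => v; rewrite app_id /app /= zero_lfunE.
by apply/eqP; rewrite -memv0 -X0 memvf.
Qed.

Lemma schur_dhom X (f : 'End(dcar X)) : simple_obj (X : Obj C) ->
  f \in dhom X X -> exists a, f = a *: \1%VF.
Proof.
move=> sX fH; have [a e] := schur_scalar Css (dmorph fH : @Hom k C X X) sX.
exists a; apply/lfunP => v; have := congr1 (fun f : @Hom k C X X => app f v) e.
by rewrite app_dmorph app_scale app_id scale_lfunE id_lfunE.
Qed.

(** Cyclicity of the trace turns each term into the trace of A composed with [e_(g ^ h)], and for
    fixed [h] these idempotents sum to 1. *)
Lemma tr_avg X (A : 'End(dcar X)) : tr (avg A) = #|H|%:R * tr A.
Proof.
have -> : avg A = \sum_g \sum_h (dact X (e_ g h) \o (A \o dact X (e_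
  (g ^ h)%g h^-1%g)))%VF.
  by rewrite pair_big; apply: eq_bigr => p _; rewrite comp_lfunA.
rewrite exchange_big tr_sum; under eq_bigr => h _.
  rewrite tr_sum; under eq_bigr => g _.
    rewrite trC -comp_lfunA.
    have -> : (dact X (e_ (g ^ h)%g h^-1%g) \o dact X (e_ g h))%VF = dact X (e_
      (g ^ h)%g 1%g).
      apply/lfunP => v; rewrite comp_lfunE dactME invgK conjgE mulVg.
      by rewrite -mulgA eqxx.
    over.
  rewrite -tr_sum -(reindex_inj (P := xpredT) (F := fun g =>
    (A \o dact X (e_ g 1%g))%VF) (conjg_inj h)) /=.
  have -> : \sum_g (A \o dact X (e_ g 1%g))%VF = A.
    by apply/lfunP => v; rewrite sum_lfunE; under eq_bigr do rewrite comp_lfunE;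
      rewrite -linear_sum dact1E.
  over.
by rewrite sumr_const mulr_natl.
Qed.

Lemma chi_orth X : simple_obj (X : Obj C) ->
  \sum_g \sum_h chi X (e_ g h) * chi X (e_ (g ^ h)%g h^-1%g) = #|H|%:R.
Proof.
move=> sX; rewrite chi_product.
have dX : (\dim {:dcar X})%:R != 0 :> k by rewrite pnatr_eq0 -lt0n
  simple_dim_gt0.
(* The average of a matrix unit is a scalar, so only the diagonal units contribute, each with the
   scalar read off from [tr_avg]. *)
transitivity (\sum_(i < \dim {:dcar X}) (#|H|%:R / (\dim {:dcar X})%:R : k)).
  apply: eq_bigr => i _; rewrite (bigD1 i) //= big1 ?addr0 => [|j ji].
    have [a e] := schur_dhom sX (avg_dhom (rank_one i
      ((vbasis fullv)`_i : dcar X))).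
    have := congr1 (@tr k _) e; rewrite tr_avg trZ tr1.
    rewrite e scale_lfunE id_lfunE linearZ /= coord_free ?(basis_free
      (vbasisP _)) // eqxx mulr1.
    rewrite /tr (bigD1 i) //= big1 => [|l li].
      rewrite rank_oneE linearZ /= coord_free ?(basis_free (vbasisP _)) // eqxx.
      by rewrite !mulr1 addr0 mulr1 => ->; rewrite mulfK.
    rewrite rank_oneE linearZ /= !coord_free ?(basis_free (vbasisP _)) //.
    by rewrite (negPf li) !(mul0r, mulr0).
  have [a e] := schur_dhom sX (avg_dhom (rank_one i
    ((vbasis fullv)`_j : dcar X))).
  rewrite e scale_lfunE id_lfunE linearZ /= coord_free ?(basis_free
    (vbasisP _)) //.
  by rewrite eq_sym (negPf ji) mulr0.
by rewrite sumr_const card_ord -[LHS]mulr_natr mulfVK.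
Qed.

Section SMatrix.
Variables (n : nat) (S : 'I_n -> Obj C).
Hypothesis S_complete : complete_simples S.

Definition smatrix : 'M[k]_n := \matrix_(i, j)
  \sum_g \sum_h chi (S i) (e_ g h) * chi (S j) (e_ h g).

(** The double braiding sends [u ⊗ v] to the sum over [g], [h] of [h e_g u ⊗ e_h g v]; [tr_tens]
    multiplies the traces, and [h e_g] has the same trace as [e_g h]. *)
Lemma rtrace_double_braiding i j :
  rtrace (brd (S j) (S i) ∘ brd (S i) (S j)) = smatrix i j *: idm 𝟙.
Proof.
apply: app_inj => a; rewrite app_rtrace /smatrix mxE.
have -> : app ((\sum_g \sum_h chi (S i) (e_ g h) * chi (S j)
  (e_ h g)) *: idm 𝟙) a =
    (\sum_g \sum_h chi (S i) (e_ g h) * chi (S j) (e_ h g)) * a.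
  by rewrite app_scale app_id.
rewrite mulrC; congr (_ * _).
rewrite (@tr_tens k _ _ (H * H)%type _ (fun p =>
  dact (S i) (e_ (p.2 * p.1 * p.2^-1)%g p.2))
  (fun p => dact (S j) (e_ p.2 p.1))).
  rewrite pair_big; apply: eq_bigr => -[g h] _ /=.
  by rewrite -!/(chi _ _) chi_gdbl_dbl.
move=> u v; rewrite -[LHS]/(app (brd (S j) (S i) ∘ brd (S i) (S j)) (pure u v)).
rewrite app_comp app_brd app_sum -(pair_big xpredT xpredT (fun g h =>
  pure (dact (S i) (e_ (h * g * h^-1)%g h) u) (dact (S j) (e_ h g) v))) /=.
apply: eq_bigr => g _; rewrite app_brd; apply: eq_bigr => h _.
by rewrite gdbl_dbl dbl_gdbl mulg1 mul1g.
Qed.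

(** On a simple module [z] is a scalar, which vanishes since its trace does and the characteristic
    is zero. The regular module is a sum of simples, so [z] annihilates it, in particular the
    element 1. *)
Lemma central_zero (z : double k H) :
  (forall X, dact X z \in dhom X X) -> (forall j, chi (S j) z = 0) -> z = 0.
Proof.
move=> zH z0; have [_ _ S3] := S_complete.
have zS j : dact (S j) z = 0.
  have sj : simple_obj (S j) by case: S_complete.
  have [a e] := schur_dhom sj (zH (S j)).
  have := z0 j; rewrite /chi e trZ tr1 => /eqP; rewrite mulf_eq0 pnatr_eq0.
  by rewrite -[_ == 0%N]negbK -lt0n simple_dim_gt0 // orbF => /eqP ->;
    rewrite scale0r.
have [m [U [i [p [U1 _ _ U4]]]]] := all_sum_of_simples Css (dreg k H : Obj C).
rewrite -[z]mulr1 -dact_reg.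
rewrite -[1 : double k H](app_id (X := dreg k H)) -U4.
have -> : app (\sum_j (i j ∘ p j)) (1 : double k H) = \sum_j app (i j) (app
  (p j) (1 : double k H)).
  by rewrite app_sumf; apply: eq_bigr => j _; rewrite app_comp.
have dact_sum (F : 'I_m -> dcar (dreg k H)) :
  dact (dreg k H) z (\sum_j F j) = \sum_j dact (dreg k H) z
    (F j) by exact: linear_sum.
rewrite dact_sum big1 // => j _; rewrite -app_dact.
have [l [f [g [gf _]]]] := S3 _ (U1 j).
rewrite -[app (p j) _](app_id) -gf app_comp -app_dact zS zero_lfunE.
by rewrite /app !linear0.
Qed.

Lemma smatrix_unit : smatrix \in unitmx.
Proof.
rewrite -row_free_unit -kermx_eq0; apply/rowV0P => c /sub_kermxP cT.
pose phi g h := \sum_i c 0 i * chi (S i) (e_ g h).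
have phi_conj g h x : phi (g ^ x)%g (h ^ x)%g = phi g h.
  by apply: eq_bigr => i _; rewrite chi_conj.
have phi0 g h : (g ^ h)%g != g -> phi g h = 0.
  by move=> gh; rewrite /phi big1 // => i _; rewrite chi_support ?mulr0.
pose z : double k H := \sum_g \sum_h phi g h *: e_ h g.
have zE X v : dact X z v = \sum_g \sum_h phi g h *: dact X (e_ h g) v.
  rewrite linear_sum sum_lfunE; apply: eq_bigr => g _ /=.
  rewrite linear_sum sum_lfunE; apply: eq_bigr => h _ /=.
  by rewrite linearZ scale_lfunE.
(* Conjugation by [b] preserves the coefficients of [z]. They are supported on commuting pairs,
   where [g] fixes [h], so [e_a] selects the terms with [h = a] on both sides. *)
have zH X : dact X z \in dhom X X.
  apply: dhom_basisP => a b v; rewrite !zE linear_sum /=.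
  rewrite [RHS](reindex_inj (conjg_inj b)) /=; apply: eq_bigr => g _.
  rewrite linear_sum [RHS](reindex_inj (conjg_inj b)) /=; apply: eq_bigr => h _.
  rewrite phi_conj linearZ /= !dactME !conjgE !mulgA mulgV !mul1g mulgK.
  have [gh|/phi0 ->] := eqVneq (g ^ h)%g g; last by rewrite !scale0r.
  have -> : (h == g * a * g^-1)%g = (a == h).
    have hg : (g * h * g^-1)%g = h by rewrite (conjgC g h) gh mulgK.
    by rewrite -{1}hg (inj_eq (mulIg _)) (inj_eq (mulgI _)) eq_sym.
  by have [->|] := eqVneq a h; rewrite ?mulgK.
have phi_sum (F : H -> H -> k) : \sum_g \sum_h phi g h * F g h =
    \sum_i c 0 i * \sum_g \sum_h chi (S i) (e_ g h) * F g h.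
  under [RHS]eq_bigr => i _.
    rewrite mulr_sumr; under eq_bigr => g _ do rewrite mulr_sumr.
    over.
  rewrite [RHS]exchange_big; apply: eq_bigr => g _.
  rewrite [RHS]exchange_big; apply: eq_bigr => h _.
  by rewrite mulr_suml; apply: eq_bigr => i _; rewrite mulrA.
have z0 : z = 0.
  apply: central_zero => // j.
  (* The trace of [z] on the simple object [S j] is the entry [j] of the product of [c] with the
     S-matrix. *)
  transitivity ((c *m smatrix) 0 j); last by rewrite cT mxE.
  rewrite mxE; under [RHS]eq_bigr do rewrite mxE.
  rewrite -phi_sum /chi linear_sum tr_sum; apply: eq_bigr => g _.
  rewrite linear_sum tr_sum; apply: eq_bigr => h _ /=.
  by rewrite linearZ trZ.
have phiz g h : phi g h = 0.
  have := congr1 (fun x : double k H => x (h, g)) z0.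
  rewrite sum_ffunE (bigD1 g) //= sum_ffunE (bigD1 h) //= !ffunE eqxx.
  rewrite big1 => [|h' hh];
    last by rewrite !ffunE xpair_eqE eq_sym (negPf hh) scaler0.
  rewrite big1 => [|g' gg]; last first.
    rewrite sum_ffunE big1 // => h' _.
    by rewrite !ffunE xpair_eqE [g == _]eq_sym (negPf gg) andbF scaler0.
  by rewrite !addr0 /GRing.scale /= mulr1.
apply/rowP => j; rewrite mxE.
have [sS iS _] := S_complete.
(* Pairing the vanishing [phi] with the dual character of [S j] isolates [c 0 j] times the order of
   H. *)
have := phi_sum (fun g h => chi (S j) (e_ (g ^ h)%g h^-1%g)).
rewrite big1 => [|g _]; last by rewrite big1 // => h _; rewrite phiz mul0r.
rewrite (bigD1 j) //= chi_orth // big1 => [|i ij]; last first.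
  rewrite chi_orth_neq ?mulr0 // => /iS e.
  by rewrite e eqxx in ij.
rewrite addr0.
by move/esym/eqP; rewrite mulf_eq0 (negPf cardH_neq0) orbF => /eqP.
Qed.

End SMatrix.

Lemma double_modular : modular C.
Proof.
split; first exact: double_braided_spherical_fusion cardH_neq0.
have [_ [n [S S_complete]]] : finite_semisimple C.
  by case: (double_braided_spherical_fusion cardH_neq0) => -[].
exists n, S, (smatrix S); split=> //.
  exact: rtrace_double_braiding.
exact: smatrix_unit.
Qed.

End Characters.

(** * Descent along the central extension *)

Section Descent.
Local Open Scope cat_scope.
Variables (k : numClosedFieldType) (A Gt G : finGroupType).
Variables (i : {morphism [set: A] >-> Gt}) (pi : {morphism [set: Gt] >-> G}).
Hypothesis ker_pi : (i @* [set: A] = 'ker pi)%g.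
Hypothesis pi_surj : (pi @* [set: Gt] = [set: G])%g.
Hypothesis iZ : (i @* [set: A] \subset 'Z([set: Gt]))%g.
Local Notation C := (double_mod k Gt).
Local Notation e_ := (@dbl k _).
Local Notation D := (trivial_component k iZ).

Lemma piM x y : pi (x * y)%g = (pi x * pi y)%g.
Proof. by rewrite morphM ?inE. Qed.

Lemma piV x : pi x^-1%g = (pi x)^-1%g.
Proof. by rewrite morphV ?inE. Qed.

Lemma piJ x y : pi (x ^ y)%g = (pi x ^ pi y)%g.
Proof. by rewrite morphJ ?inE. Qed.

Lemma pi_i a : pi (i a) = 1%g.
Proof.
have : i a \in ('ker pi)%g by rewrite -ker_pi mem_morphim ?inE.
by move/mker.
Qed.

(** A set-theoretic section of [pi]; the default 1 is never reached, by surjectivity. *)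
Definition lift_G (g : G) : Gt := odflt 1%g [pick x | pi x == g].

Lemma lift_GK g : pi (lift_G g) = g.
Proof.
rewrite /lift_G; case: pickP => [x /eqP //|nx].
have : g \in (pi @* [set: Gt])%g by rewrite pi_surj inE.
by case/morphimP => x _ _ e; have := nx x; rewrite e eqxx.
Qed.

Lemma trivial_component_retract (X Y : Obj C) : retract_of Y X ->
  has_trivial_degree iZ X -> has_trivial_degree iZ Y.
Proof.
case=> [j [p pj1]] /trivial_degreeP dX; apply/trivial_degreeP => a v.
by rewrite -[v](app_id (X := Y)) -pj1 app_comp -(app_dact p) dX.
Qed.

Lemma trivial_component_biproduct (X Y : Obj C) :
  has_trivial_degree iZ X -> has_trivial_degree iZ Y ->
  exists S (i1 : Hom X S) (i2 : Hom Y S) (p1 : Hom S X) (p2 : Hom S Y),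
    has_trivial_degree iZ S /\
    [/\ p1 ∘ i1 = idm X, p2 ∘ i2 = idm Y, p1 ∘ i2 = 0, p2 ∘ i1 = 0
      & i1 ∘ p1 + i2 ∘ p2 = idm S].
Proof.
move=> /trivial_degreeP dX /trivial_degreeP dY.
have [i1 [i2 [p1 [p2 H]]]] := dplus_biproduct X Y.
exists (dplus X Y), i1, i2, p1, p2; split=> //.
by apply/trivial_degreeP => a [u v]; rewrite dact_plus /= dX dY.
Qed.

Lemma trivial_component_braided_spherical_fusion : braided_spherical_fusion D.
Proof.
apply: full_sub_braided_spherical_fusion.
- exact: trivial_component_retract.
- exact: trivial_component_biproduct.
- exact: double_split_regular (cardH_neq0 k Gt).
- exact: double_braided_spherical_fusion (cardH_neq0 k Gt).
Qed.

(** Two lifts of an element of G differ by an element of A, which acts as the identity. *)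
Lemma pi_fiber_act (X : dmod k Gt) x y y' (v : X) : has_trivial_degree iZ X ->
  pi y = pi y' -> dact X (e_ x y) v = dact X (e_ x y') v.
Proof.
move=> /trivial_degreeP dX yy'.
have : (y^-1 * y')%g \in ('ker pi)%g.
  by apply/kerP; rewrite ?inE // piM piV yy' mulVg.
rewrite -ker_pi => /morphimP[a _ _ e].
by rewrite -[v in LHS](dX a) dbl_gdbl -e mulKVg.
Qed.

(** * The functor to D(G)-modules: regrading along [pi] *)

Section Push.
Variable X : dmod k Gt.
Hypothesis dX : has_trivial_degree iZ X.

(* The value of lift_G does not matter, by pi_fiber_act.                      *)
Definition dpush_act : 'Hom(double k G, 'End(dcar X)) :=
  dlift (fun g h => \sum_(x | pi x == g) dact X (e_ x (lift_G h))).

Lemma dpush_actE g y (v : X) :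
  dpush_act (e_ g (pi y)) v = \sum_(x | pi x == g) dact X (e_ x y) v.
Proof.
rewrite dliftE sum_lfunE; apply: eq_bigr => x _.
by apply: pi_fiber_act => //; rewrite lift_GK.
Qed.

Lemma dpush1_subproof (v : X) : \sum_g dpush_act (e_ g 1%g) v = v.
Proof.
rewrite -[RHS]dact1E [RHS](partition_big pi xpredT) //=.
by apply: eq_bigr => g _; rewrite -(morph1 pi) dpush_actE.
Qed.

(** The product of [e_x y] and [e_x' y'] survives only for [x' = x ^ y], and this [x'] lies over
    [g'] exactly when the compatibility condition holds in G. *)
Lemma dpushM_subproof g h g' h' (v : X) :
  dpush_act (e_ g h) (dpush_act (e_ g' h') v) =
    if g == (h * g' * h^-1)%g then dpush_act (e_ g (h * h')%g) v else 0.
Proof.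
rewrite -(lift_GK h) -(lift_GK h') -piM !dpush_actE.
move: (lift_G h) (lift_G h') => y y'.
transitivity (\sum_(x | pi x == g)
    if g == (pi y * g' * (pi y)^-1)%g then dact X (e_ x (y * y')%g) v else 0).
  apply: eq_bigr => x /eqP <-; rewrite linear_sum /=.
  under eq_bigr do rewrite dactME.
  have E x' : (x == y * x' * y^-1)%g = (x' == x ^ y)%g.
    apply/eqP/eqP => ->; first by rewrite conjgE !mulgA mulVg mul1g mulgKV.
    by rewrite conjgE !mulgA mulgV mul1g mulgK.
  have [e|ne] := eqVneq (pi x) (pi y * g' * (pi y)^-1)%g.
    rewrite (bigD1 (x ^ y)%g) /=; last first.
      by rewrite piJ e conjgE !mulgA mulVg mul1g mulgKV.
    by rewrite E eqxx big1 ?addr0 // => x' /andP[_ /negPf nx]; rewrite E nx.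
  rewrite big1 // => x' /eqP x'g; case: eqP => // e; case/eqP: ne.
  by rewrite e !piM piV x'g.
by case: ifP => // _; rewrite big1.
Qed.

Definition dpush : dmod k G := build_dmod dpush1_subproof dpushM_subproof.

Lemma dact_push g y (v : X) :
  dact dpush (e_ g (pi y)) v = \sum_(x | pi x == g) dact X (e_ x y) v.
Proof. exact: dpush_actE. Qed.

Lemma dact_push_gdbl y (v : X) :
  dact dpush (gdbl k (pi y)) v = dact X (gdbl k y) v.
Proof.
rewrite !gdblE [RHS](partition_big pi xpredT) //=.
by apply: eq_bigr => g _; rewrite dact_push.
Qed.

Lemma dact_push1 g (v : X) :
  dact dpush (e_ g 1%g) v = \sum_(x | pi x == g) dact X (e_ x 1%g) v.
Proof. by rewrite -(morph1 pi) dact_push. Qed.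

End Push.

Definition push_obj (X : Obj D) : dmod k G := dpush (svalP X).

Lemma push_mor_subproof (X Y : Obj D) (f : Hom X Y) :
  vsval f \in dhom (push_obj X) (push_obj Y).
Proof.
apply: dhom_basisP => g h v; rewrite -(lift_GK h) !dact_push linear_sum.
by apply: eq_bigr => x _; exact: (dhomP _ (subvsP f)).
Qed.

Lemma push_unit_subproof :
  \1%VF \in dhom (dunit k G) (push_obj (@uobj k D)).
Proof.
apply: dhom_basisP => g h v; rewrite -(lift_GK h) dact_push !id_lfunE.
rewrite /= dunit_actE counitE; under eq_bigr do rewrite dunit_actE counitE.
rewrite -scaler_suml; congr (_ *: _).
have [->|g1] := eqVneq g 1%g.
  rewrite (bigD1 1%g) ?morph1 //= eqxx big1 ?addr0 // => x /andP[_ /negPf ->].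
  by [].
rewrite big1 // => x /eqP px; case: eqP => // x1; case/eqP: g1.
by rewrite -px x1 morph1.
Qed.

(** Both actions are the sum over all pairs of degrees in Gt whose product lies over [g], grouped by
    the images of the two factors or by their product. Hence the monoidal constraint can be the
    identity map. *)
Lemma dact_push_tens (X Y : dmod k Gt) (dX : has_trivial_degree iZ X)
    (dY : has_trivial_degree iZ Y) (dXY : has_trivial_degree iZ (dtens X Y))
    g h (t : tens (dcar X) (dcar Y)) :
  dact (dtens (dpush dX) (dpush dY)) (e_ g h) t = dact (dpush dXY) (e_ g h) t.
Proof.
elim/tens_ind: t => [u v|s t Es Et]; last by rewrite !linearD /= Es Et.
rewrite -(lift_GK h) [LHS]dtens_actE [RHS]dact_push.
pose F x y : tens (dcar X) (dcar Y) :=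
  pure (dact X (e_ x (lift_G h)) u) (dact Y (e_ y (lift_G h)) v).
transitivity (\sum_(p : Gt * Gt | pi (p.1 * p.2)%g == g) F p.1 p.2).
  rewrite (partition_big (fun p : Gt * Gt => (pi p.1, pi p.2))
    (fun q => (q.1 * q.2)%g == g)) => [|p]; last by rewrite piM.
  apply: eq_bigr => -[a b] /eqP ab.
  transitivity (\sum_(p : Gt * Gt | (pi p.1 == a) && (pi p.2 == b)) F p.1 p.2).
    rewrite -(pair_big (fun x => pi x == a) (fun y => pi y == b) F) !dact_push.
    rewrite [LHS](pure_suml (U := dcar X) (V := dcar Y)); apply: eq_bigr => x _.
    exact: (pure_sumr (U := dcar X) (V := dcar Y)).
  apply: eq_bigl => -[x y] /=.
  rewrite xpair_eqE piM; case: eqP => [->|]; rewrite ?andbF //=.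
  by case: eqP => [->|]; rewrite ?andbF // ab eqxx.
rewrite (partition_big (fun p : Gt * Gt => (p.1 * p.2)%g) (fun z =>
  pi z == g)) //.
apply: eq_bigr => z /eqP zg; rewrite [RHS]dtens_actE;
  apply: eq_bigl => -[x y] /=.
by case: ((x * y)%g =P z) => [->|]; rewrite ?andbF // zg eqxx.
Qed.

Section PushTensor.
Variables X Y : dmod k Gt.
Hypotheses (dX : has_trivial_degree iZ X) (dY : has_trivial_degree iZ Y).
Hypothesis dXY : has_trivial_degree iZ (dtens X Y).

Definition dpush_tens_map :
    'Hom(dcar (dtens (dpush dX) (dpush dY)), dcar (dpush dXY)) :=
  (\1%VF : 'End(tens (dcar X) (dcar Y))).

Lemma dpush_tens_mapE t : dpush_tens_map t = t.
Proof. exact: (@id_lfunE _ (tens (dcar X) (dcar Y))). Qed.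

Lemma dpush_tens_subproof :
  dpush_tens_map \in dhom (dtens (dpush dX) (dpush dY)) (dpush dXY).
Proof.
apply: dhom_basisP => g h t; rewrite !dpush_tens_mapE.
exact: dact_push_tens.
Qed.

Definition dpush_tens : dHom (dtens (dpush dX) (dpush dY)) (dpush dXY) :=
  dmorph dpush_tens_subproof.

End PushTensor.

Definition push_mor (X Y : Obj D) (f : Hom X Y) :
    @Hom k (double_mod k G) (push_obj X) (push_obj Y) :=
  dmorph (push_mor_subproof f).

Definition push_unit : @Hom k (double_mod k G) uobj (push_obj (@uobj k D)) :=
  dmorph push_unit_subproof.

Definition push_mon (X Y : Obj D) :
    @Hom k (double_mod k G)
      (tobj (C := double_mod k G) (push_obj X) (push_obj Y))
      (push_obj (X ⊗ Y)) :=
  dpush_tens (svalP X) (svalP Y) (svalP (X ⊗ Y)).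

Definition push : functor_data D (double_mod k G) :=
  @FunctorData k D (double_mod k G) push_obj push_mor push_unit push_mon.

Lemma app_push X Y (f : @Hom k D X Y) v :
  app (fmor push f) v = @app k Gt (sval X) (sval Y) f v.
Proof. by []. Qed.

Lemma app_push_unit v : app (funit push) v = v.
Proof. exact: id_lfunE. Qed.

Lemma app_push_mon X Y v : app (fmon push X Y) v = v.
Proof. exact: dpush_tens_mapE. Qed.

Lemma push_tensor : tensor_functor push.
Proof.
split.
- split.
  + by move=> X; apply: val_inj.
  + by move=> X Y Z g f; apply: val_inj.
  + move=> X Y a f f'; apply: app_inj => v; rewrite app_comb !app_push.
    exact: (@app_comb k Gt (sval X) (sval Y) a f f' v).
- split.
    apply: (@is_iso_of_inverse k G _ _ (funit push) \1%VF) => v;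
    by rewrite app_push_unit id_lfunE.
  move=> X Y; apply: (@is_iso_of_inverse k G _ _ (fmon push X Y) \1%VF) => v;
  by rewrite app_push_mon id_lfunE.
- move=> X X' Y Y' f g; apply: tensor_ext => u v.
  rewrite [LHS]app_comp [RHS]app_comp !app_push_mon app_tmor app_push.
  by apply: esym; exact: (@app_tmor k Gt (sval X) (sval X') (sval Y) (sval Y')).
- move=> X Y Z; apply: tensor3_ext => u v w.
  rewrite [LHS]app_comp [in LHS]app_comp app_tmor !app_push_mon app_id app_push.
  rewrite [RHS]app_comp [in RHS]app_comp app_asc app_tmor !app_push_mon app_id.
  exact: (@app_asc k Gt (sval X) (sval Y) (sval Z)).
- move=> X; split; apply: tensor_ext => u v.
    rewrite [RHS]app_comp [in RHS]app_comp app_tmor app_push_unit app_push_mon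
      app_id.
    rewrite app_push app_lun; apply: esym; exact: (@app_lun k Gt (sval X)).
  rewrite [RHS]app_comp [in RHS]app_comp app_tmor app_push_unit app_push_mon
    app_id.
  rewrite app_push app_run; apply: esym; exact: (@app_run k Gt (sval X)).
Qed.

(** Grouping the R-matrix of D(Gt) by the fibres of [pi] gives that of D(G), since [x] acts on the
    second module through [pi x]. *)
Lemma push_braided : braided_functor push.
Proof.
move=> X Y; apply: tensor_ext => u v.
rewrite [LHS]app_comp [RHS]app_comp !app_push_mon app_push app_brd.
apply: etrans (@app_brd k Gt (sval X) (sval Y) u v) _.
rewrite [LHS](partition_big pi xpredT) //=; apply: eq_bigr => g _.
rewrite (dact_push1 (svalP X)); apply: esym.
apply: etrans (pure_sumr (U := dcar (sval Y)) (V := dcar (sval X)) _ _ _) _.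
by apply: eq_bigr => x /eqP <-; rewrite (dact_push_gdbl (svalP Y)).
Qed.

Lemma push_twist : twist_preserving push.
Proof.
move=> X; apply: app_inj => v; rewrite app_push app_twist.
apply: etrans (@app_twist k Gt (sval X) v) _.
rewrite [LHS](partition_big pi xpredT) //=; apply: eq_bigr => g _.
have := dact_push (svalP X) g (lift_G g) v; rewrite lift_GK => ->.
(* In the term [e_x x] of the twist the group element may be replaced by the chosen lift of
   [pi x]. *)
apply: eq_bigr => x /eqP <-; apply: pi_fiber_act; first exact: svalP.
by rewrite lift_GK.
Qed.

(** * Modules of functions on Gt and dominance *)

Section Induced.
Variable Y : dmod k G.
Local Notation V := {ffun Gt -> dcar Y}.

(* A D(Gt)-module is a Gt-graded space with a compatible action of Gt, so no  *)
(* condition relating the value f x to the grading of Y is needed.            *)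
Definition dpull_act : 'Hom(double k Gt, 'End(V)) :=
  dlift (fun g h => linfun (fun f : V =>
    [ffun x => if x == g then dact Y (gdbl k (pi h)) (f
      (x ^ h)%g) else 0] : V)).

Lemma dpull_actE g h (f : V) x : dpull_act (e_ g h) f x =
  if x == g then dact Y (gdbl k (pi h)) (f (x ^ h)%g) else 0.
Proof.
rewrite dliftE linfunE ?ffunE // => a f1 f2; apply/ffunP => y; rewrite !ffunE.
by case: ifP => _; rewrite ?linearP ?scaler0 ?addr0.
Qed.

Lemma dpull1_subproof (f : V) : \sum_g dpull_act (e_ g 1%g) f = f.
Proof.
apply/ffunP => x; rewrite sum_ffunE (bigD1 x) //= big1 => [|g gx].
  by rewrite addr0 dpull_actE eqxx morph1 conjg1 gdbl1.
by rewrite dpull_actE eq_sym (negPf gx).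
Qed.

Lemma dpullM_subproof g h g' h' (f : V) :
  dpull_act (e_ g h) (dpull_act (e_ g' h') f) =
    if g == (h * g' * h^-1)%g then dpull_act (e_ g (h * h')%g) f else 0.
Proof.
apply/ffunP => x; rewrite !dpull_actE.
have -> : (g == h * g' * h^-1)%g = (g ^ h == g')%g.
  apply/eqP/eqP => [->|<-]; first by rewrite conjgE !mulgA mulVg mul1g mulgKV.
  by rewrite conjgE !mulgA mulgV mul1g mulgK.
have [->|xg] := eqVneq x g; last first.
  by case: ifP => _; rewrite ?dpull_actE ?ffunE // (negPf xg).
case: ifP => gg; last by rewrite linear0 ffunE.
by rewrite dpull_actE eqxx gdblM piM conjgM.
Qed.

Definition dpull : dmod k Gt := build_dmod dpull1_subproof dpullM_subproof.

(** The element [i a] is central, so it does not move the argument, and it acts on values through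
    [pi (i a) = 1]. *)
Lemma dpull_trivial : has_trivial_degree iZ dpull.
Proof.
apply/trivial_degreeP => a f; rewrite gdblE; apply/ffunP => x.
rewrite sum_ffunE (bigD1 x) //= big1 => [|g gx]; last first.
  by rewrite dpull_actE eq_sym (negPf gx).
rewrite addr0 dpull_actE eqxx pi_i gdbl1; congr (f _).
have /centerP[_ /(_ x (in_setT x)) c] := morph_central iZ a.
by rewrite conjgE -c mulKg.
Qed.

Lemma dact_push_pull (d : has_trivial_degree iZ dpull) g y (f : V) x :
  dact (dpush d) (e_ g (pi y)) f x =
  if pi x == g then dact Y (gdbl k (pi y)) (f (x ^ y)%g) else 0.
Proof.
rewrite dact_push sum_ffunE; case: ifP => xg.
  rewrite (bigD1 x) //= big1 => [|z /andP[_ zx]].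
    by rewrite addr0 dpull_actE eqxx.
  by rewrite dpull_actE eq_sym (negPf zx).
rewrite big1 // => z zg; rewrite dpull_actE; case: eqP => // e.
by rewrite e zg in xg.
Qed.

Definition ker_size : k := #|[pred x | pi x == 1%g]|%:R.

Lemma ker_size_neq0 : ker_size != 0.
Proof.
by rewrite pnatr_eq0 -lt0n; apply/card_gt0P; exists 1%g; rewrite inE morph1.
Qed.

(** The fibre over [g] is a translate of the kernel. *)
Lemma fiber_sum g (v : dcar Y) : \sum_(x | pi x == g) v = ker_size *: v.
Proof.
rewrite (reindex_inj (mulIg (lift_G g))) /=.
rewrite (eq_bigl [pred x | pi x == 1%g]) => [|x]; last first.
  by rewrite piM lift_GK /= -[X in _ == X]mul1g (inj_eq (mulIg _)).
by rewrite sumr_const scaler_nat.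
Qed.

(** In the composite each [e_g] occurs once for every point of the fibre over [g], which the factor
    [ker_size^-1] compensates. The proof [d] is arbitrary so that the lemma fits the one packed in
    the object of the trivial component. *)
Lemma pull_retract (d : has_trivial_degree iZ dpull) :
  exists (j : @Hom k (double_mod k G) Y (dpush d))
    (p : @Hom k (double_mod k G) (dpush d) Y),
    p ∘ j = @idm k (double_mod k G) Y.
Proof.
pose j (v : dcar Y) : V := [ffun x => ker_size^-1 *: dact Y (e_ (pi x) 1%g) v].
pose p (f : V) : dcar Y := \sum_x dact Y (e_ (pi x) 1%g) (f x).
have lj : linear j.
  by move=> a u v; apply/ffunP => x;
    rewrite !ffunE linearP scalerDr !scalerA mulrC.
have lp : linear p.
  move=> a u v; rewrite /p scaler_sumr -big_split; apply: eq_bigr => x _.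
  by rewrite !ffunE linearP.
have hj : linfun j \in dhom Y (dpush d).
  apply: dhom_basisP => g h v; rewrite !(linfunE lj) -(lift_GK h).
  apply/ffunP => x; rewrite dact_push_pull !ffunE dactME !(mul1g, mulg1, invg1).
  case: eqP => _; last by rewrite scaler0.
  rewrite linearZ /= gdbl_dbl mulg1 piJ; congr (_ *: dact Y (e_ _ _) v).
  by rewrite conjgE !mulgA mulgV mul1g mulgK.
have hp : linfun p \in dhom (dpush d) Y.
  apply: dhom_basisP => g h f; rewrite !(linfunE lp) -(lift_GK h) /p.
  move: (lift_G h) => y; rewrite linear_sum /= [RHS](reindex_inj
    (conjg_inj y)) /=.
  apply: eq_bigr => x _; rewrite (dact_push_pull d) dactME piJ.
  have -> : (g == pi y * (pi x ^ pi y) * (pi y)^-1)%g = (pi x == g).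
    by rewrite conjgE !mulgA mulgV mul1g mulgK eq_sym.
  case: eqP => [->|_]; last by rewrite linear0.
  by rewrite dbl_gdbl mul1g mulg1.
exists (dmorph hj), (dmorph hp); apply: app_inj => v.
rewrite app_comp app_id !app_dmorph (linfunE lp) (linfunE lj) /p.
transitivity (\sum_x ker_size^-1 *: dact Y (e_ (pi x) 1%g) v).
  by apply: eq_bigr => x _;
    rewrite ffunE linearZ /= dactME !(mul1g, mulg1, invg1) eqxx.
rewrite -scaler_sumr (partition_big pi xpredT) //=.
transitivity (ker_size^-1 *: \sum_g ker_size *: dact Y (e_ g 1%g) v).
  congr (_ *: _); apply: eq_bigr => g _; rewrite -(fiber_sum g).
  by apply: eq_bigr => x /eqP ->.
by rewrite -scaler_sumr dact1E scalerA mulVf ?scale1r ?ker_size_neq0.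
Qed.

End Induced.

Lemma push_dominant : dominant push.
Proof.
move=> Y; exists (exist _ _ (dpull_trivial Y)).
exact: pull_retract (svalP (exist _ _ (dpull_trivial Y))).
Qed.

Lemma trivial_component_modularization :
  is_modularization D (double_mod k G).
Proof.
split.
- exact: trivial_component_braided_spherical_fusion.
- exact: double_modular.
- exists push; split; [exact: push_tensor | exact: push_braided
  | exact: push_twist | exact: push_dominant].
Qed.

End Descent.

Theorem proposition4p3 (R : realType) (A Gt G : finGroupType)
  (i : {morphism [set: A] >-> Gt}) (pi : {morphism [set: Gt] >-> G})
  (A_cyclic : cyclic [set: A])
  (i_inj : ('injm i)%g)
  (exact : (i @* [set: A] = 'ker pi)%g)
  (pi_surj : (pi @* [set: Gt] = [set: G])%g)
  (i_central : (i @* [set: A] \subset 'Z([set: Gt]))%g) :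
  is_modularization
    (trivial_component (complex R) i_central)
    (double_mod (complex R) G).
Proof. exact: trivial_component_modularization exact pi_surj i_central. Qed.
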